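(* Let $d\ge 1$, let $G$ be a finite group of linear isometries of $\mathbb{R}^d$, let $\theta^*\in\mathbb{R}^d$, and let $Y_1,Y_2,\ldots$ be a sequence of i.i.d. random vectors distributed according to $\mathbb{P}_{\theta^*}$. For $n\ge 1$, let $\hat\theta_n$ be the maximum likelihood estimator of $\theta^*$ obtained from $Y_1,\ldots,Y_n$. Let $H=\{g\in G: g\theta^*=\theta^*\}$ and $\bar H=\frac{1}{|H|}\sum_{g\in H}g$. Then there exists a (random, i.e. possibly data-dependent) sequence $(g_n)_{n\ge 1}$ of elements of $G$ such that (i) $n^{1/2}\,\|\bar H(g_n\hat\theta_n-\theta^* )\|=O_{\mathbb{P}_{\theta^*}}(1)$; (ii) $n^{1/4}\,\|(I-\bar H)(g_n\hat\theta_n-\theta^* )\|=O_{\mathbb{P}_{\theta^*}}(1)$.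
   Context: For $\theta\in\mathbb{R}^d$, $\mathbb{P}_\theta=\frac{1}{|G|}\sum_{g\in G}\mathcal{N}(g\theta,I)$ is the uniform mixture of Gaussian distributions with means $g\theta$, $g\in G$, and identity covariance matrix, with Lebesgue density $L(y,\theta)=\frac{1}{|G|(2\pi)^{d/2}}\sum_{g\in G}e^{-\frac12\|y-g\theta\|^2}$. A maximum likelihood estimator $\hat\theta_n$ is a (measurable) maximizer over $\theta\in\mathbb{R}^d$ of $\hat\Psi_n(\theta)=\frac1n\sum_{i=1}^n\log L(Y_i,\theta)$. $\|\cdot\|$ is the Euclidean norm and $I$ the identity matrix. $Z_n=O_{\mathbb{P}_{\theta^*}}(1)$ means that $(Z_n)$ is bounded in probability (tight) when the $Y_i$ are i.i.d. from $\mathbb{P}_{\theta^*}$. *)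

(* Defs.v *)
From HB Require Import structures.
From mathcomp Require Import all_boot all_order all_algebra finmap.
From mathcomp Require Import all_classical all_reals all_analysis.

Set Implicit Arguments.
Unset Strict Implicit.
Unset Printing Implicit Defensive.

Import Order.TTheory GRing.Theory Num.Theory.
Import numFieldNormedType.Exports.

Local Open Scope classical_set_scope.
Local Open Scope ring_scope.

(* Matrices carry the product sigma-algebra, generated by the entries (as is
   done for tuples in the library). Over a realType this is the Borel
   sigma-algebra of the finite-dimensional space 'M_(m, n). *)
Definition measure_matrix_display : measure_display -> measure_display.
Proof. exact. Qed.

Section measurable_matrix.
Context {d} {T : measurableType d}.
Variables m n : nat.

Definition entry_preimages : set (set 'M[T]_(m, n)) :=
  [set A | exists i j (B : set T),
    measurable B /\ A = (fun M : 'M[T]_(m, n) => M i j) @^-1` B].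

Let matrix_set0 : <<s entry_preimages >> set0.
Proof. exact: sigma_algebra0. Qed.

Let matrix_setC A : <<s entry_preimages >> A -> <<s entry_preimages >> (~` A).
Proof. exact: sigma_algebraC. Qed.

Let matrix_bigcup (F : (set 'M[T]_(m, n))^nat) :
  (forall i, <<s entry_preimages >> (F i)) ->
  <<s entry_preimages >> (\bigcup_i F i).
Proof. exact: sigma_algebra_bigcup. Qed.

HB.instance Definition _ := @isMeasurable.Build (measure_matrix_display d)
  'M[T]_(m, n) <<s entry_preimages >> matrix_set0 matrix_setC matrix_bigcup.

End measurable_matrix.

Lemma measurable_entry d (T : measurableType d) m n (i : 'I_m) (j : 'I_n) :
  measurable_fun [set: 'M[T]_(m, n)] (fun M : 'M[T]_(m, n) => M i j).
Proof.
move=> _ B mB; rewrite setTI; apply: sub_sigma_algebra.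
by exists i, j, B.
Qed.

Lemma measurable_fun_matrixP d1 d2 (T1 : measurableType d1)
    (T2 : measurableType d2) m n (f : T1 -> 'M[T2]_(m, n)) :
  measurable_fun [set: T1] f <->
  forall i j, measurable_fun [set: T1] (fun x => f x i j).
Proof.
split=> [mf i j|mf].
  exact: (measurableT_comp (@measurable_entry _ T2 m n i j) mf).
apply: (@measurability _ _ _ _ _ _ (@entry_preimages _ T2 m n)) => //.
move=> _ [_ [i [j [B [mB ->]]]] <-].
exact: (mf i j measurableT B mB).
Qed.

(* Lebesgue measure on R^d, as the d-fold product of lebesgue_measure
   (whose domain is the alias measurableTypeR R of R). *)
Section lebesgue_cV.
Context {R : realType}.

Definition cV_cons n (p : measurableTypeR R * 'cV[R]_n) : 'cV[R]_n.+1 :=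
  col_mx ((p.1 : R)%:M : 'M[R]_1) p.2.

Definition cV_uncons n (v : 'cV[R]_n.+1) :
    measurableTypeR R * 'cV[R]_n :=
  (v ord0 0, dsubmx (v : 'cV[R]_(1 + n))).

Lemma cV_consK n : cancel (@cV_cons n) (@cV_uncons n).
Proof.
case=> x v; rewrite /cV_uncons /cV_cons /= col_mxKd; congr (_, _).
by rewrite mxE; case: splitP => // k _; rewrite mxE !ord1.
Qed.

Lemma measurable_cV_cons n : measurable_fun [set: measurableTypeR R * 'cV[R]_n] (@cV_cons n).
Proof.
apply/measurable_fun_matrixP => i j; rewrite /cV_cons.
case: (@splitP 1 n i) => k ik.
  rewrite (_ : (fun _ => _) = fst) //; apply/funext => -[x v] /=.
  rewrite (_ : i = lshift n k); last exact/val_inj.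
  by rewrite (col_mxEu (x%:M : 'M[R]_1)) mxE !ord1.
rewrite (_ : (fun _ => _) = (fun v : 'cV[R]_n => v k j) \o snd).
  by apply: measurableT_comp => //; exact: measurable_entry.
apply/funext => -[x v] /=.
rewrite (_ : i = rshift 1 k); last exact/val_inj.
by rewrite (col_mxEd (x%:M : 'M[R]_1)).
Qed.

Lemma measurable_cV_uncons n : measurable_fun [set: 'cV[R]_n.+1] (@cV_uncons n).
Proof.
apply: measurable_fun_pair; first exact: measurable_entry.
apply/measurable_fun_matrixP => i j.
rewrite (_ : (fun _ => _) = fun v : 'cV[R]_n.+1 => v (rshift 1 i) j).
  exact: measurable_entry.
by apply/funext => v; rewrite mxE.
Qed.

Section step.
Variables (n : nat) (mu : {sigma_finite_measure set 'cV[R]_n -> \bar R}).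

Definition lebesgue_step : set 'cV[R]_n.+1 -> \bar R :=
  pushforward (@lebesgue_measure R \x mu)%E (@cV_cons n).

Let measurable_preimage (A : set 'cV[R]_n.+1) :
  measurable A -> measurable (@cV_cons n @^-1` A).
Proof.
by move=> mA; rewrite -[X in measurable X]setTI; exact: measurable_cV_cons.
Qed.

Let lebesgue_step0 : lebesgue_step set0 = 0%E.
Proof. by rewrite /lebesgue_step /pushforward preimage_set0 measure0. Qed.

Let lebesgue_step_ge0 A : (0 <= lebesgue_step A)%E.
Proof. by rewrite /lebesgue_step /pushforward; exact: measure_ge0. Qed.

Let lebesgue_step_sigma_additive : semi_sigma_additive lebesgue_step.
Proof.
move=> F mF tF mUF; rewrite /lebesgue_step /pushforward preimage_bigcup.
apply: measure_semi_sigma_additive.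
- by move=> i; exact: measurable_preimage.
- apply/trivIsetP => /= i j _ _ ij; rewrite -preimage_setI.
  by move/trivIsetP : tF => /(_ _ _ _ _ ij) ->//; rewrite preimage_set0.
- by rewrite -preimage_bigcup; exact: measurable_preimage.
Qed.

HB.instance Definition _ := isMeasure.Build _ _ _ lebesgue_step
  lebesgue_step0 lebesgue_step_ge0 lebesgue_step_sigma_additive.

Let lebesgue_step_sigma_finite : sigma_finite setT lebesgue_step.
Proof.
have /sigma_finiteP[F [TF ndF Foo]] := sigma_finiteT (@lebesgue_measure R).
have /sigma_finiteP[G [TG ndG Goo]] := sigma_finiteT mu.
exists (fun k => @cV_uncons n @^-1` (F k `*` G k)).
  rewrite -preimage_bigcup -[LHS](@preimage_setT _ _ (@cV_uncons n)).
  congr (_ @^-1` _); rewrite -setXTT TF TG predeqE => -[x y]; split.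
    move=> [/= [i _ Fx] [k _ Gy]]; exists (maxn i k) => //; split.
    - by move: x Fx; exact/subsetPset/ndF/leq_maxl.
    - by move: y Gy; exact/subsetPset/ndG/leq_maxr.
  by move=> [i _ []/= ? ?]; split; exists i.
move=> k; have [mF Fk] := Foo k; have [mG Gk] := Goo k; split.
  rewrite -[X in measurable X]setTI.
  by apply: measurable_cV_uncons => //; exact: measurableX.
rewrite /lebesgue_step /pushforward -comp_preimage.
rewrite (_ : _ \o _ = id) ?preimage_id; last by apply/funext; exact: cV_consK.
by rewrite product_measure1E// lte_mul_pinfty// ge0_fin_numE.
Qed.

HB.instance Definition _ := Measure_isSigmaFinite.Build _ _ _
  lebesgue_step lebesgue_step_sigma_finite.

End step.

Fixpoint lebesgue_cV d : {sigma_finite_measure set 'cV[R]_d -> \bar R} :=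
  match d with
  | 0 => \d_(0 : 'cV[R]_0)
  | d'.+1 => lebesgue_step (lebesgue_cV d')
  end.

End lebesgue_cV.

Section model.
Context {R : realType} {d : nat}.
Implicit Types (y theta m : 'cV[R]_d) (G : {fset 'M[R]_d}).

(* The library norm `|v| on matrices is the sup norm. *)
Definition enorm y : R := Num.sqrt (\sum_i y i 0 ^+ 2).

Definition linear_isometry (g : 'M[R]_d) : Prop :=
  forall x : 'cV[R]_d, enorm (g *m x) = enorm x.

Definition isometry_group G : Prop :=
  [/\ 1%:M \in G,
      {in G &, forall g h, g *m h \in G},
      {in G, forall g, invmx g \in G} &
      {in G, forall g, linear_isometry g}].

Definition gaussian_pdf m y : R :=
  ((2 * pi) `^ (d%:R / 2))^-1 * expR (- (enorm (y - m) ^+ 2 / 2)).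

Definition gaussian_law m (A : set 'cV[R]_d) : \bar R :=
  (\int[lebesgue_cV d]_(y in A) (gaussian_pdf m y)%:E)%E.

Definition mixture_law G theta (A : set 'cV[R]_d) : \bar R :=
  ((#|` G|%:R^-1)%:E * \sum_(g <- G) gaussian_law (g *m theta) A)%E.

Definition likelihood G y theta : R :=
  (#|` G|%:R * (2 * pi) `^ (d%:R / 2))^-1 *
  \sum_(g <- G) expR (- (enorm (y - g *m theta) ^+ 2 / 2)).

Definition log_likelihood G n (ys : n.-tuple 'cV[R]_d) theta : R :=
  n%:R^-1 * \sum_(i < n) ln (likelihood G (tnth ys i) theta).

Definition is_mle G n (that : n.-tuple 'cV[R]_d -> 'cV[R]_d) : Prop :=
  measurable_fun setT that /\
  forall ys theta, log_likelihood G ys theta <= log_likelihood G ys (that ys).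

Definition stabilizer G theta : {fset 'M[R]_d} :=
  [fset g in G | g *m theta == theta]%fset.

Definition mx_average (H : {fset 'M[R]_d}) : 'M[R]_d :=
  #|` H|%:R^-1 *: \sum_(h <- H) h.

End model.

Section probability.
Context {d} {T : measurableType d} {R : realType} (P : probability T R).

Definition mutually_independent d' (E : measurableType d')
    (X : nat -> {RV P >-> E}) : Prop :=
  forall (J : {fset nat}) (A : nat -> set E),
    (forall j, j \in J -> measurable (A j)) ->
    P (\bigcap_(j in [set` J]) X j @^-1` A j) =
    (\prod_(j <- J) P (X j @^-1` A j))%E.

(* The term of index 0 is ignored: sequences start at n = 1. *)
Definition bounded_in_probability (Z : nat -> T -> R) : Prop :=
  forall e : R, 0 < e -> exists M : R, forall n, (0 < n)%N ->
    (P [set w | (M < `|Z n w|)%R] <= e%:E)%E.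

Definition sample (E : Type) (X : nat -> T -> E) n (w : T) : n.-tuple E :=
  [tuple X i w | i < n].

End probability.

(* Main.v *)
Require Import Defs.
From mathcomp Require Import all_boot all_order all_algebra finmap.
From mathcomp Require Import all_classical all_reals all_analysis.
From mathcomp Require Import measurable_realfun ring lra.

Set Implicit Arguments.
Unset Strict Implicit.
Unset Printing Implicit Defensive.

Import Order.TTheory GRing.Theory Num.Theory.
Import numFieldNormedType.Exports.

Local Open Scope classical_set_scope.
Local Open Scope ring_scope.

(* Let rho be the likelihood ratio of the parameter theta + dl to theta, where
   theta + dl is the estimator moved by g_n to the point of its orbit nearest to
   theta, and put r = |Hbar dl| + |dl|^2. Both claims follow from
   r = O_P(n^(-1/2)), which is proved without a separate consistency step.
   - Since ln x <= x - 1 - (sqrt x - 1)^2, maximality bounds the empirical mean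
     of (sqrt rho - 1)^2 by that of rho - 1, which is a pure fluctuation because
     rho has mean 1 under the true law. By Cauchy-Schwarz, for a test function
     psi, the empirical mean of (rho - 1) psi is then controlled by the square
     root of this fluctuation.
   - rho is a weighted mean of exponentials exp <y, g dl>. Its first-order term
     in dl only involves Hbar dl, so expanding all orders shows that the
     fluctuations of rho psi are O_P(n^(-1/2)) r, uniformly over a ball in dl
     (the estimator is bounded by twice the empirical mean of |Y|).
   - The true mean of rho psi is computed for exponential polynomials psi, and
     such psi can be chosen to be sensitive to Hbar dl at first order and to dl
     at second order, so that these means jointly dominate r.
   Hence r <= a n^(-1/2) r + b sqrt (n^(-1/2) r), which gives the rate. *)

(** * Inequalities and Euclidean isometries *)

(** When the stabilizer of [theta] is nontrivial, the Fisher information degenerates on the kernel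
    of [Hbar], so a second-order expansion of the log-likelihood has no quadratic lower bound there.
    The rate argument therefore meets the logarithm only through an upper bound, and every expansion
    is made in the ratio itself, an entire function of the displacement whose Taylor series is
    controlled on a ball of any radius. Exponential polynomials are the natural tests because
    Gaussian tilting turns the mean of a suitable lift into the value of the polynomial at the
    centre: the true mean of rho psi becomes the average of an explicit function over the orbit of
    theta + dl. A test that vanishes on the orbit of theta is centred under the true law; if it
    vanishes to second order at the other orbit points, only the elements fixing theta contribute at
    first order, and their average is what produces [Hbar]. Moving the estimator to the orbit point
    nearest to theta keeps it at a definite distance from the other orbit points, whatever the size
    of dl. Separation thus holds on the whole ball and not only near 0. *)

Section real_inequalities.
Context {R : realType}.

(** The form x^2 A + 2 x y C + y^2 B is a sum of squares. At (B, -C) it equals B (A B - C^2); if B =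
    0, at (-C, A + 1) it equals -(A + 2) C^2, which forces C = 0. *)
Lemma sqr_sum_mul_le (I : Type) (s : seq I) (a b : I -> R) :
  (\sum_(i <- s) a i * b i) ^+ 2 <=
  (\sum_(i <- s) a i ^+ 2) * (\sum_(i <- s) b i ^+ 2).
Proof.
set A := \sum_(i <- s) a i ^+ 2; set B := \sum_(i <- s) b i ^+ 2.
set C := \sum_(i <- s) a i * b i.
have A0 : 0 <= A by apply: sumr_ge0 => i _; exact: sqr_ge0.
have B0 : 0 <= B by apply: sumr_ge0 => i _; exact: sqr_ge0.
have key x y : 0 <= x ^+ 2 * A + 2 * x * y * C + y ^+ 2 * B.
  rewrite /A /B /C !mulr_sumr -!big_split /=.
  apply: sumr_ge0 => i _.
  by rewrite (_ : _ + _ = (x * a i + y * b i) ^+ 2) ?sqr_ge0//; ring.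
have [B00|B1] := eqVneq B 0.
  have := key (- (A + 1) * C) 1.
  have := key (- C) (A + 1).
  rewrite B00 => h1 h2.
  have := key 1 (- C * (A + 1)). rewrite B00.
  nra.
have Bp : 0 < B by rewrite lt_def B1.
by have := key B (- C); nra.
Qed.

(** Since (k + K)! >= K! k!, the shifted tail is at most |x|^K / K! times a partial sum of the
    series of exp |x|; the bound then passes to the limit. *)
Lemma expR_tail (x : R) K :
  `|expR x - \sum_(k < K) x ^+ k / k`!%:R| <= `|x| ^+ K / K`!%:R * expR `|x|.
Proof.
have le_series N y : 0 <= y -> series (exp_coeff y) N <= expR y.
  move=> y0; apply: nondecreasing_cvgn_le; last exact: is_cvg_series_exp_coeff.
  by apply: nondecreasing_series => k _ _; exact: exp_coeff_ge0.
have step N : `|series (exp_coeff x) (N + K)%N - \sum_(k < K) x ^+ k / k`!%:R|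
    <= `|x| ^+ K / K`!%:R * expR `|x|.
  rewrite (_ : series _ _ = \sum_(k < K) x ^+ k / k`!%:R +
     \sum_(k < N) x ^+ (k + K) / (k + K)`!%:R); last first.
    rewrite /series /= (big_cat_nat (n := K))//= ?leq_addl//.
    congr (_ + _).
      by rewrite big_mkord; apply: eq_bigr => i _; rewrite exp_coeffE mulrC.
    rewrite -{1}(add0n K) big_addn addnK big_mkord.
    by apply: eq_bigr => i _; rewrite exp_coeffE mulrC.
  rewrite addrAC subrr add0r.
  apply: le_trans (ler_norm_sum _ _ _) _.
  apply: (@le_trans _ _ (`|x| ^+ K / K`!%:R * series (exp_coeff `|x|) N)); last first.
    by rewrite ler_wpM2l ?le_series// divr_ge0 ?exprn_ge0 ?ler0n.
  rewrite /series /= big_mkord mulr_sumr; apply: ler_sum => k _.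
  rewrite exp_coeffE /= normrM normfV (ger0_norm (ler0n _ _)) normrX exprD.
  rewrite [leRHS](_ : _ = `|x| ^+ k * `|x| ^+ K / (K`! * k`!)%:R); last first.
    by rewrite natrM invfM; ring.
  rewrite ler_wpM2l ?mulr_ge0 ?exprn_ge0//.
  rewrite lef_pV2 ?posrE ?ltr0n ?muln_gt0 ?fact_gt0//.
  rewrite ler_nat -(@bin_fact (k + K) K) ?leq_addl// addnK.
  by rewrite leq_pmull// bin_gt0 leq_addl.
have cv : `|series (exp_coeff x) (N + K)%N - \sum_(k < K) x ^+ k / k`!%:R|
    @[N --> \oo] --> `|expR x - \sum_(k < K) x ^+ k / k`!%:R|.
  apply: cvg_norm; apply: cvgB; last exact: cvg_cst.
  have := is_cvg_series_exp_coeff x; rewrite -/(expR x).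
  by rewrite -(cvg_shiftn K) => h.
by apply: (cvgr_to_le cv); exact: nearW.
Qed.

Lemma exprn_le_expR (x : R) k : 0 <= x -> x ^+ k / k`!%:R <= expR x.
Proof.
move=> x0; case: k => [|k]; first by rewrite expr0 fact0 divr1 -expR0 ler_expR.
by apply: le_trans (expR_ge1Dxn k x0); rewrite lerDr.
Qed.

Lemma expR_sub1_le (x : R) : `|expR x - 1| <= `|x| * expR `|x|.
Proof.
have := expR_tail x 1; rewrite big_ord_recl big_ord0 expr0 fact0 !divr1 addr0.
by rewrite expr1.
Qed.

Lemma expR_sub1_ge (x : R) : `|x| * expR (- `|x|) <= `|expR x - 1|.
Proof.
have [x0|x0] := leP 0 x.
  rewrite !ger0_norm ?subr_ge0 -?expR0 ?ler_expR//.
  have := expR_ge1Dx x; have : expR (- x) <= 1 by rewrite expR_le1 oppr_le0.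
  by rewrite expR0 => ? ?; nra.
rewrite ltr0_norm// ler0_norm ?subr_le0 ?expR_le1 ?(ltW x0)// opprK.
have := expR_ge1Dx (- x); have := expR_gt0 x.
have : expR x * expR (- x) = 1 by rewrite -expRD subrr expR0.
by nra.
Qed.

(** With s = sqrt x the right-hand side is 2 (s - 1), so this is ln s <= s - 1 doubled; the square
    left over is the Hellinger term. *)
Lemma ln_le_sqrt (x : R) : 0 < x -> ln x <= x - 1 - (Num.sqrt x - 1) ^+ 2.
Proof.
move=> x0; have s0 : 0 < Num.sqrt x by rewrite sqrtr_gt0.
rewrite -[x in ln x](sqr_sqrtr (ltW x0)) lnXn//.
have := le_ln1Dx (x := Num.sqrt x - 1).
rewrite (addrC 1) subrK => /(_ ltac:(lra)) h.
rewrite -[X in _ <= X - 1 - _](sqr_sqrtr (ltW x0)).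
rewrite -mulr_natl; nra.
Qed.

Lemma ln_le_add (a b x : R) : 0 < a -> 0 < b -> b <= a * expR x ->
  ln b <= ln a + x.
Proof.
move=> a0 b0 bax; rewrite -[x in _ + x]expRK -lnM ?posrE ?expR_gt0//.
by rewrite ler_ln ?posrE ?mulr_gt0 ?expR_gt0.
Qed.

(** Applied to the norm t of the estimator and the mean norm m of the observations, once the
    estimator has been compared with the parameter 0. *)
Lemma le_double (t m : R) : 0 <= t -> 0 <= m -> 0 <= t * m - t ^+ 2 / 2 ->
  t <= 2 * m.
Proof.
move=> t0 m0 h; have [->|tn0] := eqVneq t 0; first by rewrite mulr_ge0.
have tp : 0 < t by rewrite lt_def tn0.
rewrite -(ler_pM2l tp); lra.
Qed.

End real_inequalities.

Section euclidean.
Context {R : realType} {d : nat}.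
Implicit Types (x y z : 'cV[R]_d) (g h : 'M[R]_d).

Definition dot x y : R := \sum_i x i 0 * y i 0.

Lemma dotC x y : dot x y = dot y x.
Proof. by apply: eq_bigr => i _; rewrite mulrC. Qed.

Lemma dotDl x y z : dot (x + y) z = dot x z + dot y z.
Proof. by rewrite -big_split; apply: eq_bigr => i _; rewrite mxE mulrDl. Qed.

Lemma dotDr x y z : dot x (y + z) = dot x y + dot x z.
Proof. by rewrite !(dotC x) dotDl. Qed.

Lemma dotZl a x y : dot (a *: x) y = a * dot x y.
Proof. by rewrite mulr_sumr; apply: eq_bigr => i _; rewrite mxE mulrA. Qed.

Lemma dotZr a x y : dot x (a *: y) = a * dot x y.
Proof. by rewrite !(dotC x) dotZl. Qed.

Lemma dotNr x y : dot x (- y) = - dot x y.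
Proof. by rewrite -scaleN1r dotZr mulN1r. Qed.

Lemma dotNl x y : dot (- x) y = - dot x y.
Proof. by rewrite -scaleN1r dotZl mulN1r. Qed.

Lemma dot0l x : dot 0 x = 0.
Proof. by rewrite /dot big1// => i _; rewrite mxE mul0r. Qed.

Lemma dot0r x : dot x 0 = 0.
Proof. by rewrite dotC dot0l. Qed.

Lemma dot_sumr (I : Type) (s : seq I) (F : I -> 'cV[R]_d) x :
  dot x (\sum_(i <- s) F i) = \sum_(i <- s) dot x (F i).
Proof.
elim: s => [|i s ih]; first by rewrite !big_nil dot0r.
by rewrite !big_cons dotDr ih.
Qed.

Lemma dot_delta x i : dot x (delta_mx i 0) = x i 0.
Proof.
rewrite /dot (bigD1 i)//= big1 ?addr0; first by rewrite mxE !eqxx mulr1.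
by move=> j ji; rewrite mxE (negbTE ji) mulr0.
Qed.

Lemma dot_mulmx g x y : dot (g *m x) y = dot x (g^T *m y).
Proof.
have dE u v : dot u v = (u^T *m v) 0 0.
  by rewrite mxE; apply: eq_bigr => i _; rewrite mxE.
by rewrite !dE trmx_mul mulmxA.
Qed.

Lemma dotxx_ge0 x : 0 <= dot x x.
Proof. by apply: sumr_ge0 => i _; rewrite -expr2 sqr_ge0. Qed.

Lemma enorm_dot x : enorm x = Num.sqrt (dot x x).
Proof. by congr Num.sqrt; apply: eq_bigr => i _; rewrite expr2. Qed.

Lemma sqr_enorm x : enorm x ^+ 2 = dot x x.
Proof. by rewrite enorm_dot sqr_sqrtr ?dotxx_ge0. Qed.

Lemma enorm_ge0 x : 0 <= enorm x. Proof. exact: sqrtr_ge0. Qed.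

Lemma enorm_eq0 x : enorm x = 0 -> x = 0.
Proof.
move=> /eqP; rewrite -sqrf_eq0 sqr_enorm /dot.
rewrite psumr_eq0 => [/allP x0|i _]; last by rewrite -expr2 sqr_ge0.
apply/matrixP => i j; rewrite ord1 mxE; apply/eqP.
by have := x0 i (mem_index_enum i); rewrite /= mulf_eq0 orbb.
Qed.

Lemma enormZ a x : enorm (a *: x) = `|a| * enorm x.
Proof.
by rewrite !enorm_dot dotZl dotZr mulrA -expr2 sqrtrM ?sqr_ge0// sqrtr_sqr.
Qed.

Lemma enormN x : enorm (- x) = enorm x.
Proof. by rewrite -scaleN1r enormZ normrN1 mul1r. Qed.

Lemma dot_le x y : `|dot x y| <= enorm x * enorm y.
Proof.
rewrite -(@ler_pXn2r _ 2)// ?nnegrE ?mulr_ge0 ?enorm_ge0//.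
rewrite real_normK ?num_real// exprMn /enorm !sqr_sqrtr;
  try by apply: sumr_ge0 => i _; exact: sqr_ge0.
exact: sqr_sum_mul_le.
Qed.

Lemma enorm_le x a : 0 <= a -> dot x x <= a ^+ 2 -> enorm x <= a.
Proof.
move=> a0 h; rewrite -(@ler_pXn2r _ 2)// ?nnegrE ?enorm_ge0//.
by rewrite sqr_enorm.
Qed.

Lemma enormD x y : enorm (x + y) <= enorm x + enorm y.
Proof.
apply: enorm_le; first by rewrite addr_ge0 ?enorm_ge0.
rewrite dotDl !dotDr (dotC y x) -!sqr_enorm.
have := le_trans (ler_norm _) (dot_le x y); nra.
Qed.

Lemma enormB x y : enorm (x - y) <= enorm x + enorm y.
Proof. by rewrite -(enormN y) enormD. Qed.

Lemma enorm_sum (I : Type) (s : seq I) (F : I -> 'cV[R]_d) :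
  enorm (\sum_(i <- s) F i) <= \sum_(i <- s) enorm (F i).
Proof.
elim: s => [|i s ih]; first by rewrite !big_nil enorm_dot dot0l sqrtr0.
by rewrite !big_cons (le_trans (enormD _ _))// lerD2l.
Qed.

Lemma le_enorm x i : `|x i 0| <= enorm x.
Proof.
rewrite -(dot_delta x i) (le_trans (dot_le _ _))//.
by rewrite [X in _ * X]enorm_dot dot_delta mxE !eqxx sqrtr1 mulr1.
Qed.

Lemma enorm_le_sum x : enorm x <= \sum_i `|x i 0|.
Proof.
have xE : x = \sum_i x i 0 *: delta_mx i 0 :> 'cV_d.
  rewrite [LHS]matrix_sum_delta; apply: eq_bigr => i _.
  by rewrite big_ord1.
rewrite {1}xE; apply: (le_trans (enorm_sum _ _)); apply: ler_sum => i _.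
by rewrite enormZ [X in _ * X]enorm_dot dot_delta mxE !eqxx sqrtr1 mulr1.
Qed.

End euclidean.

Section isometry_group_theory.
Context {R : realType} {d : nat} (G : {fset 'M[R]_d}).
Hypothesis isoG : isometry_group G.
Implicit Types (x y : 'cV[R]_d) (g h : 'M[R]_d).

Lemma iso1 : 1%:M \in G. Proof. by case: isoG. Qed.
Lemma isoM g h : g \in G -> h \in G -> g *m h \in G.
Proof. by move=> gG hG; case: isoG => _ GM _ _; exact: GM. Qed.
Lemma isoV g : g \in G -> invmx g \in G.
Proof. by move=> gG; case: isoG => _ _ GV _; exact: GV. Qed.

Lemma iso_enorm g x : g \in G -> enorm (g *m x) = enorm x.
Proof. by move=> gG; case: isoG => _ _ _ iG; exact: iG. Qed.

(** Polarization: the inner product is recovered from the norm of x + y. *)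
Lemma iso_dot g x y : g \in G -> dot (g *m x) (g *m y) = dot x y.
Proof.
move=> gG; have e z : dot (g *m z) (g *m z) = dot z z.
  by rewrite -!sqr_enorm iso_enorm.
have := e (x + y); rewrite mulmxDr !dotDl !dotDr !e.
by rewrite (dotC (g *m y)) (dotC y); lra.
Qed.

Lemma iso_unit g : g \in G -> g \in unitmx.
Proof.
move=> gG; suff : g^T *m g = 1%:M by move/mulmx1_unit; case.
apply/matrixP => i j.
have := iso_dot (delta_mx i 0) (delta_mx j 0) gG.
rewrite dot_mulmx mulmxA dotC dot_delta -colE mxE => ->.
by rewrite dot_delta !mxE eqxx andbT eq_sym.
Qed.

Lemma isoVK g x : g \in G -> g *m (invmx g *m x) = x.
Proof. by move=> gG; rewrite mulmxA mulmxV ?mul1mx ?iso_unit. Qed.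

Lemma sum_iso_mulr (V : nmodType) (F : 'M[R]_d -> V) g : g \in G ->
  \sum_(h <- G) F (h *m g) = \sum_(h <- G) F h.
Proof.
move=> gG; rewrite -(big_map (fun h => h *m g) xpredT F).
apply: perm_big; apply: uniq_perm.
- rewrite map_inj_uniq ?fset_uniq// => h k e.
  by rewrite -(mulmxK (iso_unit gG) h) e mulmxK ?iso_unit.
- exact: fset_uniq.
- move=> h; apply/mapP/idP => [[k kG ->]|hG]; first exact: isoM.
  by exists (h *m invmx g); [rewrite isoM ?isoV|rewrite mulmxKV ?iso_unit].
Qed.

Lemma cardG_gt0 : 0 < #|` G|%:R :> R.
Proof. by rewrite ltr0n cardfs_gt0; apply/fset0Pn; exists 1%:M; exact: iso1. Qed.

End isometry_group_theory.

(** * Gaussian integrals *)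

Section density.
Local Open Scope ereal_scope.
Context d (T : measurableType d) (R : realType).
Variables (mu nu : {measure set T -> \bar R}) (f : T -> R).
Hypotheses (mf : measurable_fun setT f) (f0 : forall x, (0 <= f x)%R).
Hypothesis muE : forall A, measurable A -> mu A = \int[nu]_(x in A) (f x)%:E.

Import HBNNSimple.

(** The measure is known only through its values on sets, as the mixture law is. Both integrals are
    monotone limits along the same simple functions, for which the claim reduces to [muE] on level
    sets. *)
Lemma ge0_integral_density (h : T -> \bar R) :
  measurable_fun [set: T] h -> (forall x, 0 <= h x) ->
  \int[mu]_x h x = \int[nu]_x (h x * (f x)%:E).
Proof.
move=> mh h0; pose a := nnsfun_approx measurableT mh.
have mef : measurable_fun setT (EFin \o f) by exact/measurable_EFinP.
have acvg x : (a n x)%:E @[n --> \oo] --> h x.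
  by apply: cvg_nnsfun_approx => //.
have -> : \int[mu]_x h x = lim (\int[mu]_x (EFin \o a n) x @[n --> \oo]).
  under eq_integral do rewrite -(cvg_lim _ (acvg _))//.
  apply: monotone_convergence => //.
  - by move=> n; apply/measurable_EFinP; exact/measurable_funP.
  - by move=> n x _ /=; rewrite lee_fin.
  - by move=> x _ m n mn; rewrite lee_fin; exact/lefP/nd_nnsfun_approx.
have -> : \int[nu]_x (h x * (f x)%:E) =
    lim (\int[nu]_x ((a n x)%:E * (f x)%:E) @[n --> \oo]).
  have hf x : h x * (f x)%:E = lim ((a n x)%:E * (f x)%:E @[n --> \oo]).
    by apply/esym/cvg_lim => //; apply: cvgeZr.
  under eq_integral do rewrite hf.
  apply: monotone_convergence => //.
  - move=> n; apply: emeasurable_funM => //.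
    by apply/measurable_EFinP; exact/measurable_funP.
  - by move=> n x _ /=; rewrite mule_ge0 ?lee_fin.
  - move=> x _ m n mn; rewrite lee_wpmul2r ?lee_fin//.
    exact/lefP/nd_nnsfun_approx.
suff key n : \int[mu]_x (EFin \o a n) x = \int[nu]_x ((a n x)%:E * (f x)%:E).
  by under eq_fun do rewrite key.
transitivity (\int[mu]_x
   (\sum_(y \in range (a n)) (y * \1_(a n @^-1` [set y]) x)%:E)).
  by apply: eq_integral => t _; rewrite /= fimfunE -fsumEFin.
have mind r : measurable_fun setT (fun x => (r * \1_(a n @^-1` [set r]) x)%:E).
  by apply/measurable_EFinP; exact: measurable_funM.
rewrite ge0_integral_fsum//; last by move=> y t _; exact: nnfun_muleindic_ge0.
transitivity (\int[nu]_x (\sum_(y \in range (a n))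
    (y * \1_(a n @^-1` [set y]) x)%:E * (f x)%:E)); last first.
  apply: eq_integral => x _.
  rewrite -ge0_mule_fsuml => [|y]; last exact: nnfun_muleindic_ge0.
  by rewrite fsumEFin // -(fimfunE _ x).
rewrite ge0_integral_fsum//; last 2 first.
  - by move=> y; exact: emeasurable_funM.
  - by move=> y t _; apply: mule_ge0; [exact: nnfun_muleindic_ge0|rewrite lee_fin].
apply: eq_fsbigr => r rhn.
have r0 : (0 <= r)%R by move: rhn; rewrite inE => -[t _ <-].
under eq_integral do rewrite EFinM.
rewrite integralZl_indic_nnsfun// integral_indic// setIT muE//.
under [RHS]eq_integral do rewrite EFinM -muleA.
rewrite ge0_integralZl//; last 2 first.
- apply: emeasurable_funM => //; exact/measurable_EFinP.
- by move=> t _; rewrite mule_ge0 ?lee_fin.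
congr (_ * _).
rewrite integral_mkcond; apply: eq_integral => x _.
by rewrite epatch_indic muleC.
Qed.

End density.

Section measurability.
Context {R : realType}.

Lemma measurable_fun_dot d (T : measurableType d) n (a : 'cV[R]_n)
    (f : T -> 'cV[R]_n) :
  measurable_fun setT f -> measurable_fun setT (fun t => dot a (f t)).
Proof.
move=> /measurable_fun_matrixP mf; apply: measurable_sum => i.
by apply: measurable_funM => //; exact: mf.
Qed.

Lemma measurable_fun_sqrt d (T : measurableType d) (f : T -> R) :
  measurable_fun setT f -> measurable_fun setT (fun t => Num.sqrt (f t)).
Proof.
move=> mf; apply: (measurableT_comp _ mf).
by apply: continuous_measurable_fun; exact: sqrt_continuous.
Qed.

Lemma measurable_fun_enorm d (T : measurableType d) n (f : T -> 'cV[R]_n) :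
  measurable_fun setT f -> measurable_fun setT (fun t => enorm (f t)).
Proof.
move=> /measurable_fun_matrixP mf; apply: measurable_fun_sqrt.
by apply: measurable_sum => i; apply: measurable_funX; exact: mf.
Qed.

Lemma measurable_fun_mulmx d (T : measurableType d) m n p
    (A : T -> 'M[R]_(m, n)) (B : T -> 'M[R]_(n, p)) :
  measurable_fun setT A -> measurable_fun setT B ->
  measurable_fun setT (fun t => A t *m B t).
Proof.
move=> /measurable_fun_matrixP mA /measurable_fun_matrixP mB.
apply/measurable_fun_matrixP => i j; under eq_fun do rewrite mxE.
by apply: measurable_sum => k; exact: measurable_funM.
Qed.

Lemma measurable_fun_addmx d (T : measurableType d) m n
    (A B : T -> 'M[R]_(m, n)) :
  measurable_fun setT A -> measurable_fun setT B ->
  measurable_fun setT (fun t => A t + B t).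
Proof.
move=> /measurable_fun_matrixP mA /measurable_fun_matrixP mB.
apply/measurable_fun_matrixP => i j; under eq_fun do rewrite mxE.
exact: measurable_funD.
Qed.

Lemma measurable_gaussian_pdf n (m : 'cV[R]_n) :
  measurable_fun setT (gaussian_pdf m).
Proof.
apply: measurable_funM => //; apply: measurableT_comp => //.
apply: measurableT_comp => //; apply: measurable_funM => //.
apply: measurable_funX; apply: measurable_fun_enorm.
exact: measurable_fun_addmx.
Qed.

End measurability.

Section gaussian.
Context {R : realType}.

Lemma gaussian_pdf_ge0 n (m y : 'cV[R]_n) : 0 <= gaussian_pdf m y.
Proof. by rewrite mulr_ge0 ?expR_ge0 ?invr_ge0 ?powR_ge0. Qed.

(** Splitting off the first coordinate matches the recursive construction of [lebesgue_cV] and lets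
    Tonelli run by induction on the dimension. *)
Lemma gaussian_pdf_cons n (m : 'cV[R]_n.+1) (p : measurableTypeR R * 'cV[R]_n) :
  gaussian_pdf m (cV_cons p) =
  normal_pdf (m ord0 0) 1 p.1 * gaussian_pdf (cV_uncons m).2 p.2.
Proof.
rewrite normal_pdfE ?oner_neq0// /gaussian_pdf /normal_peak /normal_fun.
have twopi : 0 < 2 * pi :> R by rewrite mulr_gt0 ?pi_gt0.
have -> : enorm (cV_cons p - m) ^+ 2 =
    ((p.1 : R) - m ord0 0) ^+ 2 + enorm (p.2 - (cV_uncons m).2) ^+ 2.
  rewrite /enorm !sqr_sqrtr ?sumr_ge0// => [|i _|i _]; rewrite ?sqr_ge0//.
  rewrite big_ord_recl; congr (_ + _).
    have /(congr1 fst) /= := cV_consK p.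
    by rewrite /cV_uncons /= !mxE => ->.
  apply: eq_bigr => i _; have /(congr1 snd) /= := cV_consK p.
  rewrite /cV_uncons /= => /matrixP/(_ i 0); rewrite !mxE => <-.
  by rewrite (_ : lift ord0 i = rshift 1 i)//; exact: val_inj.
set a := (_ ^+ 2 in LHS); set b := enorm _ ^+ 2.
have -> : - ((a + b) / 2) = - a / (1 ^+ 2 *+ 2) + - (b / 2) :> R.
  by rewrite expr1n; field.
have -> : (n.+1)%:R / 2 = 2^-1 + n%:R / 2 :> R by rewrite -natr1; field.
rewrite expRD powRD; last by rewrite (gt_eqF twopi) implybT.
rewrite invfM powR12_sqrt ?(ltW twopi)//.
rewrite expr1n mul1r -[pi *+ 2]mulr_natl.
by rewrite mulrACA.
Qed.

Lemma integral_gaussian_pdf n (m : 'cV[R]_n) :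
  (\int[lebesgue_cV n]_y (gaussian_pdf m y)%:E = 1)%E.
Proof.
elim: n m => [|n ih] m.
  have mg : measurable_fun [set: 'cV[R]_0] (EFin \o gaussian_pdf m).
    by apply/measurable_EFinP; exact: measurable_gaussian_pdf.
  rewrite integral_dirac//.
  rewrite diracT mul1e /gaussian_pdf mul0r powRr0 invr1 mul1r.
  by rewrite /enorm big_ord0 sqrtr0 expr0n /= mul0r oppr0 expR0.
rewrite /= /lebesgue_step ge0_integral_pushforward//; last 3 first.
- exact: measurable_cV_cons.
- by apply/measurable_EFinP; exact: measurable_gaussian_pdf.
- by move=> y _; rewrite lee_fin gaussian_pdf_ge0.
rewrite preimage_setT fubini_tonelli1//=; last 2 first.
- apply/measurable_EFinP; apply: measurableT_comp.
    exact: measurable_gaussian_pdf.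
  exact: measurable_cV_cons.
- by move=> p; rewrite lee_fin gaussian_pdf_ge0.
rewrite /fubini_F /=.
rewrite -[RHS](integral_normal_pdf (m ord0 0) 1).
apply: eq_integral => x _.
transitivity (\int[lebesgue_cV n]_y ((normal_pdf (m ord0 0) 1 x)%:E *
    (gaussian_pdf (cV_uncons m).2 y)%:E))%E.
  by apply: eq_integral => y _; rewrite -EFinM (gaussian_pdf_cons m (x, y)).
rewrite ge0_integralZl ?ih ?mule1//.
- by apply/measurable_EFinP; exact: measurable_gaussian_pdf.
- by move=> y _; rewrite lee_fin gaussian_pdf_ge0.
- by rewrite lee_fin normal_pdf_ge0.
Qed.

(** Completing the square: an exponential tilt by t translates the mean by t. Integrated over y, it
    gives exp <t, m> as the mean of exp (<t, y> - |t|^2 / 2). *)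
Lemma gaussian_pdf_tilt n (m t y : 'cV[R]_n) :
  expR (dot t y - dot t t / 2) * gaussian_pdf m y =
  expR (dot t m) * gaussian_pdf (m + t) y.
Proof.
rewrite /gaussian_pdf !sqr_enorm mulrCA [RHS]mulrCA -!expRD; congr (_ * expR _).
rewrite !(dotDl, dotDr, dotNl, dotNr, opprD) (dotC m t) (dotC y t) (dotC y m).
by field.
Qed.

End gaussian.

(** * Expectations and independence *)

Section real_integral.
Context d (T : measurableType d) (R : realType) (P : probability T R).
Implicit Types f g : T -> R.

Definition integrableR f := P.-integrable [set: T] (EFin \o f).

Definition Ex f : R := (\int[P]_w f w)%R.

Lemma integrableR_measurable f : integrableR f -> measurable_fun setT f.
Proof. by move=> /integrableP[/measurable_EFinP]. Qed.

Lemma integrableR_fin f : integrableR f -> (Ex f)%:E = (\int[P]_w (f w)%:E)%E.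
Proof. by move=> intf; rewrite fineK//; exact: integrable_fin_num. Qed.

Lemma integrableRD f g : integrableR f -> integrableR g ->
  integrableR (fun w => f w + g w).
Proof. by move=> intf intg; exact: (integrableD _ intf intg). Qed.

Lemma integrableRZ a f : integrableR f -> integrableR (fun w => a * f w).
Proof. by move=> intf; exact: (integrableZl _ a intf). Qed.

Lemma integrableR_cst a : integrableR (fun=> a).
Proof. exact: finite_measure_integrable_cst. Qed.

Lemma integrableR_le f g : measurable_fun setT f -> integrableR g ->
  (forall w, `|f w| <= g w) -> integrableR f.
Proof.
move=> mf intg fg; apply: le_integrable intg => //.
  exact/measurable_EFinP.
move=> w _; rewrite /= lee_fin; apply: le_trans (fg w) (ler_norm _).
Qed.

Lemma integrableR_norm f : integrableR f -> integrableR (fun w => `|f w|).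
Proof. by move=> intf; exact: (integrable_norm intf). Qed.

Lemma integrableR_sum (I : Type) (s : seq I) (F : I -> T -> R) :
  (forall i, integrableR (F i)) -> integrableR (fun w => \sum_(i <- s) F i w).
Proof.
move=> intF; elim: s => [|i s ih].
  by under eq_fun do rewrite big_nil; exact: integrableR_cst.
by under eq_fun do rewrite big_cons; exact: integrableRD.
Qed.

Lemma ExD f g : integrableR f -> integrableR g ->
  Ex (fun w => f w + g w) = Ex f + Ex g.
Proof. by move=> intf intg; rewrite /Ex RintegralD. Qed.

Lemma ExZ a f : integrableR f -> Ex (fun w => a * f w) = a * Ex f.
Proof. by move=> intf; rewrite /Ex RintegralZl. Qed.

Lemma Ex_cst a : Ex (fun=> a) = a.
Proof. by rewrite /Ex Rintegral_cst//= probability_setT mulr1. Qed.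

Lemma ExB f g : integrableR f -> integrableR g ->
  Ex (fun w => f w - g w) = Ex f - Ex g.
Proof. by move=> intf intg; rewrite /Ex RintegralB. Qed.

Lemma Ex_sum (I : Type) (s : seq I) (F : I -> T -> R) :
  (forall i, integrableR (F i)) ->
  Ex (fun w => \sum_(i <- s) F i w) = \sum_(i <- s) Ex (F i).
Proof.
move=> intF; elim: s => [|i s ih].
  by under [in LHS]eq_fun do rewrite big_nil; rewrite Ex_cst big_nil.
under [in LHS]eq_fun do rewrite big_cons.
by rewrite ExD ?ih ?big_cons//; exact: integrableR_sum.
Qed.

Lemma Ex_le f g : integrableR f -> integrableR g ->
  (forall w, f w <= g w) -> Ex f <= Ex g.
Proof. by move=> intf intg fg; exact: le_Rintegral. Qed.

Lemma Ex_ge0 f : (forall w, 0 <= f w) -> 0 <= Ex f.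
Proof. by move=> f0; exact: Rintegral_ge0. Qed.

Lemma Ex_norm_le f : integrableR f -> `|Ex f| <= Ex (fun w => `|f w|).
Proof. by move=> intf; exact: le_normr_Rintegral. Qed.

Lemma Ex_markov f (a c : R) : integrableR f -> (forall w, 0 <= f w) -> 0 < a ->
  Ex f <= a * c -> (P [set w | (a < f w)%R] <= c%:E)%E.
Proof.
move=> intf f0 a0 fac; have mf := integrableR_measurable intf.
have mA : measurable [set w | (a < f w)%R].
  rewrite [X in measurable X](_ : _ = f @^-1` `]a, +oo[).
    by rewrite -[X in measurable X]setTI; apply: mf.
  by apply/seteqP; split=> w /=; rewrite in_itv /= andbT.
suff : (a%:E * P [set w | (a < f w)%R] <= a%:E * c%:E)%E by rewrite lee_pmul2l.
rewrite -[X in P X]setIT -integral_indic// -ge0_integralZl//; last 2 first.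
- by apply/measurable_EFinP; exact: measurable_indic.
- by rewrite lee_fin ltW.
apply: (@le_trans _ _ (\int[P]_w (f w)%:E)%E).
  apply: ge0_le_integral => //.
  - by move=> w _; rewrite mule_ge0 ?lee_fin ?(ltW a0).
  - by apply: measurable_funeM; apply/measurable_EFinP; exact: measurable_indic.
  - exact/measurable_EFinP.
  - move=> w _; rewrite -EFinM lee_fin indicE; case: (boolP (w \in _)).
      by rewrite inE /= mulr1 => /ltW.
    by rewrite mulr0.
by rewrite -integrableR_fin// -EFinM lee_fin.
Qed.

End real_integral.

Section independent_product.
Context (d d1 d2 : measure_display) (T : measurableType d) (R : realType) (P : probability T R).
Context (E1 : measurableType d1) (E2 : measurableType d2).
Variables (X : {RV P >-> E1}) (Z : {RV P >-> E2}).
Hypothesis XZ : forall A B, measurable A -> measurable B ->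
  P (X @^-1` A `&` Z @^-1` B) = (P (X @^-1` A) * P (Z @^-1` B))%E.

Let XZpair w := (X w, Z w).

Let mXZ : measurable_fun [set: T] XZpair.
Proof. by apply: measurable_fun_pair. Qed.

Let mXZ_mixin := isMeasurableFun.Build _ _ _ _ _ mXZ.
Let XZrv : {RV P >-> (E1 * E2)%type} :=
  MeasurableFun.Pack (MeasurableFun.Class mXZ_mixin).

(** Independence on rectangles identifies the law of the pair with the product of the marginal laws,
    by uniqueness of the product measure; Fubini then factors the integral. *)
Lemma Ex_mul_indep (f : E1 -> R) (g : E2 -> R) :
  measurable_fun setT f -> measurable_fun setT g ->
  integrableR P (f \o X) -> integrableR P (g \o Z) ->
  integrableR P (fun w => f (X w) * g (Z w)) ->
  Ex P (fun w => f (X w) * g (Z w)) = Ex P (f \o X) * Ex P (g \o Z).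
Proof.
move=> mf mg intf intg intfg.
pose h (p : E1 * E2) := (f p.1 * g p.2)%:E.
have mh : measurable_fun [set: E1 * E2] h.
  apply/measurable_EFinP; apply: measurable_funM.
    exact: (measurableT_comp mf).
  exact: (measurableT_comp mg).
pose mu := (distribution P X \x distribution P Z)%E.
have muE A : measurable A -> mu A = distribution P XZrv A.
  by apply: product_measure_unique => B C mB mC; exact: XZ.
have int_h : mu.-integrable setT h.
  apply/integrableP; split => //.
  rewrite (eq_measure_integral (distribution P XZrv)); last first.
    by move=> A mA _; exact: muE.
  rewrite ge0_integral_distribution//; last exact: measurableT_comp.
  by have /integrableP[] := intfg.
have -> : Ex P (fun w => f (X w) * g (Z w)) = fine (\int[mu]_p h p)%E.
  rewrite (eq_measure_integral (distribution P XZrv)); last first.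
    by move=> A mA _; exact: muE.
  by rewrite integral_distribution.
rewrite -integral12_prod_meas1// /fubini_F.
under eq_integral.
  move=> x _; rewrite /h /=; under eq_integral do rewrite EFinM.
  rewrite integralZl//; last first.
    by apply: (integrable_pushforward (phi := Z)) => //; apply/measurable_EFinP.
  rewrite (_ : (\int[_]_y (g y)%:E)%E = (Ex P (g \o Z))%:E); last first.
    rewrite integrableR_fin// (@integral_distribution _ _ _ _ _ _ _ (EFin \o g))//.
    exact/measurable_EFinP.
  over.
rewrite integralZr//; last first.
  by apply: (integrable_pushforward (phi := X)) => //; apply/measurable_EFinP.
rewrite (@integral_distribution _ _ _ _ _ _ _ (EFin \o f))//; last first.
  exact/measurable_EFinP.
by rewrite -integrableR_fin.
Qed.

End independent_product.

(** * Subexponential functions of one observation *)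

Section subexponential.
Context {R : realType} {d : nat}.
Implicit Types f g : 'cV[R]_d -> R.

(** An algebra of functions integrable under every Gaussian mixture. It contains all the integrands
    below, so each integrability obligation becomes a closure property. *)
Definition subexp f := measurable_fun setT f /\
  exists C a, [/\ 0 <= C, 0 <= a & forall y, `|f y| <= C * expR (a * enorm y)].

Lemma subexp_measurable f : subexp f -> measurable_fun setT f.
Proof. by case. Qed.

Lemma subexp_le f g : measurable_fun setT f -> subexp g ->
  (forall y, `|f y| <= `|g y|) -> subexp f.
Proof.
move=> mf [mg [C [a [C0 a0 ga]]]] fg; split=> //; exists C, a; split => // y.
exact: le_trans (fg y) (ga y).
Qed.

Lemma subexp_expR_enorm a : 0 <= a -> subexp (fun y => expR (a * enorm y)).
Proof.
move=> a0; split; last first.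
  by exists 1, a; split=> // y; rewrite mul1r ger0_norm ?expR_ge0.
apply: measurableT_comp => //; apply: measurable_funM => //.
exact: measurable_fun_enorm.
Qed.

Lemma subexp_cst c : subexp (fun=> c).
Proof.
split=> //; exists `|c|, 0; split=> // y.
by rewrite mul0r expR0 mulr1.
Qed.

Lemma subexpD f g : subexp f -> subexp g -> subexp (fun y => f y + g y).
Proof.
move=> [mf [C [a [C0 a0 fa]]]] [mg [D [b [D0 b0 gb]]]]; split.
  exact: measurable_funD.
exists (C + D), (a + b); split; rewrite ?addr_ge0// => y.
apply: le_trans (ler_normD _ _) _; rewrite mulrDl lerD//.
  apply: le_trans (fa y) _; rewrite ler_wpM2l// ler_expR ler_wpM2r ?enorm_ge0//.
  by rewrite lerDl.
apply: le_trans (gb y) _; rewrite ler_wpM2l// ler_expR ler_wpM2r ?enorm_ge0//.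
by rewrite lerDr.
Qed.

Lemma subexpM f g : subexp f -> subexp g -> subexp (fun y => f y * g y).
Proof.
move=> [mf [C [a [C0 a0 fa]]]] [mg [D [b [D0 b0 gb]]]]; split.
  exact: measurable_funM.
exists (C * D), (a + b); split; rewrite ?mulr_ge0 ?addr_ge0// => y.
by rewrite normrM mulrDl expRD mulrACA ler_pM.
Qed.

Lemma subexpZ c f : subexp f -> subexp (fun y => c * f y).
Proof. by move=> sf; apply: subexpM => //; exact: subexp_cst. Qed.

Lemma subexpB f g : subexp f -> subexp g -> subexp (fun y => f y - g y).
Proof.
move=> sf sg; under eq_fun do rewrite -mulN1r.
by apply: subexpD => //; exact: subexpZ.
Qed.

Lemma subexp_norm f : subexp f -> subexp (fun y => `|f y|).
Proof.
move=> sf; apply: (subexp_le _ sf) => [|y]; last by rewrite normr_id.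
by apply: measurableT_comp => //; exact: subexp_measurable.
Qed.

Lemma subexp_sum (I : Type) (s : seq I) (F : I -> 'cV[R]_d -> R) :
  (forall i, subexp (F i)) -> subexp (fun y => \sum_(i <- s) F i y).
Proof.
move=> sF; elim: s => [|i s ih].
  by under eq_fun do rewrite big_nil; exact: subexp_cst.
by under eq_fun do rewrite big_cons; exact: subexpD.
Qed.

Lemma subexp_prod (I : Type) (s : seq I) (F : I -> 'cV[R]_d -> R) :
  (forall i, subexp (F i)) -> subexp (fun y => \prod_(i <- s) F i y).
Proof.
move=> sF; elim: s => [|i s ih].
  by under eq_fun do rewrite big_nil; exact: subexp_cst.
by under eq_fun do rewrite big_cons; exact: subexpM.
Qed.

Lemma subexpX f k : subexp f -> subexp (fun y => f y ^+ k).
Proof.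
move=> sf; elim: k => [|k ih].
  by under eq_fun do rewrite expr0; exact: subexp_cst.
by under eq_fun do rewrite exprS; exact: subexpM.
Qed.

Lemma measurable_dot (t : 'cV[R]_d) : measurable_fun setT (dot t).
Proof. exact: (measurable_fun_dot t (f := id)). Qed.

Lemma measurable_enorm : measurable_fun setT (@enorm R d).
Proof. exact: (measurable_fun_enorm (f := id)). Qed.

Lemma subexp_enorm : subexp (@enorm R d).
Proof.
apply: (subexp_le _ (subexp_expR_enorm ler01)); first exact: measurable_enorm.
move=> y; rewrite mul1r !ger0_norm ?enorm_ge0 ?expR_ge0//.
by have := expR_ge1Dx (enorm y); lra.
Qed.

Lemma subexp_dot (t : 'cV[R]_d) : subexp (dot t).
Proof.
apply: (subexp_le _ (subexpZ (enorm t) subexp_enorm)).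
  exact: measurable_dot.
move=> y; apply: le_trans (dot_le _ _) _.
by rewrite [leRHS]ger0_norm// mulr_ge0 ?enorm_ge0.
Qed.

Lemma subexp_expR_dot (t : 'cV[R]_d) : subexp (fun y => expR (dot t y)).
Proof.
apply: (subexp_le _ (subexp_expR_enorm (enorm_ge0 t))).
  by apply: measurableT_comp => //; exact: measurable_dot.
move=> y; rewrite !ger0_norm ?expR_ge0// ler_expR.
exact: le_trans (ler_norm _) (dot_le _ _).
Qed.

(** The norm is at most d times the largest coordinate in absolute value, so one of the 2 d linear
    exponentials dominates. Their Gaussian means are explicit, unlike that of exp (a |y|). *)
Lemma expR_enorm_le (a : R) (y : 'cV[R]_d) : (0 < d)%N -> 0 <= a ->
  expR (a * enorm y) <= \sum_i (expR (dot ((a * d%:R) *: delta_mx i 0) y) +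
                               expR (dot (- (a * d%:R) *: delta_mx i 0) y)).
Proof.
move=> d0 a0; pose i0 := Ordinal d0.
pose i := [arg max_(i > i0) `|y i 0|]%O.
have yi j : `|y j 0| <= `|y i 0|.
  by rewrite /i; case: arg_maxP => // k _ /(_ j erefl).
have le_y : enorm y <= d%:R * `|y i 0|.
  apply: le_trans (enorm_le_sum _) _.
  apply: (@le_trans _ _ (\sum_(j < d) `|y i 0|)); first exact: ler_sum.
  by rewrite sumr_const card_ord [leRHS]mulr_natl.
apply: (@le_trans _ _ (expR (a * d%:R * y i 0) + expR (- (a * d%:R) * y i 0))).
  have [yi0|yi0] := leP 0 (y i 0).
    rewrite ler_wpDr ?expR_ge0// ler_expR -mulrA ler_wpM2l//.
    by move: le_y; rewrite ger0_norm //.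
  rewrite ler_wpDl ?expR_ge0// ler_expR mulNr -mulrN -mulrA ler_wpM2l//.
  by move: le_y; rewrite ltr0_norm //.
rewrite (bigD1 i)//= !dotZl !(dotC (delta_mx _ _)) !dot_delta lerDl.
by apply: sumr_ge0 => j _; rewrite addr_ge0 ?expR_ge0.
Qed.

End subexponential.

(** * The mixture model: likelihood ratios and change of measure *)

Section mixture_model.
Context (R : realType) (d : nat) (d_gt0 : (0 < d)%N).
Context (G : {fset 'M[R]_d}) (isoG : isometry_group G) (theta : 'cV[R]_d).
Context (disp : measure_display) (T : measurableType disp).
Context (P : probability T R) (Y : nat -> {RV P >-> 'cV[R]_d}).
Hypothesis lawY : forall i (A : set 'cV[R]_d), measurable A ->
  distribution P (Y i) A = mixture_law G theta A.

Lemma likelihoodE y th : likelihood G y th =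
  #|` G|%:R^-1 * \sum_(g <- G) gaussian_pdf (g *m th) y.
Proof. by rewrite /likelihood /gaussian_pdf -mulr_sumr invfM mulrA. Qed.

Lemma likelihood_ge0 y th : 0 <= likelihood G y th.
Proof.
rewrite likelihoodE mulr_ge0 ?invr_ge0//.
by apply: sumr_ge0 => g _; exact: gaussian_pdf_ge0.
Qed.

Lemma likelihood_gt0 y th : 0 < likelihood G y th.
Proof.
rewrite /likelihood mulr_gt0 ?invr_gt0 ?mulr_gt0 ?powR_gt0 ?mulr_gt0 ?pi_gt0//.
  exact: cardG_gt0.
rewrite (big_fsetD1 1%:M)/=; last exact: iso1.
by rewrite ltr_pwDl ?expR_gt0// sumr_ge0// => g _; exact: expR_ge0.
Qed.

Lemma measurable_likelihood th : measurable_fun setT (fun y => likelihood G y th).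
Proof.
under eq_fun do rewrite likelihoodE.
by apply: measurable_funM => //; apply: measurable_sum => g; exact: measurable_gaussian_pdf.
Qed.

Lemma integral_sample (h : 'cV[R]_d -> R) i :
  measurable_fun setT h -> (forall y, 0 <= h y) ->
  (\int[P]_w (h (Y i w))%:E =
   \int[lebesgue_cV d]_y (h y * likelihood G y theta)%:E)%E.
Proof.
move=> mh h0.
rewrite -(ge0_integral_distribution (Y i) (f := EFin \o h))//; last first.
  exact/measurable_EFinP.
rewrite (@ge0_integral_density _ _ _ _ (lebesgue_cV d)
  (fun y => likelihood G y theta))//.
- exact: measurable_likelihood.
- by move=> y; exact: likelihood_ge0.
- move=> A mA; rewrite [LHS](lawY i mA) /mixture_law /gaussian_law.
  under [RHS]eq_integral do rewrite likelihoodE EFinM.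
  have mg g : measurable_fun A (fun y => (gaussian_pdf (g *m theta) y)%:E).
    by apply: measurable_funTS; apply/measurable_EFinP; exact: measurable_gaussian_pdf.
  rewrite ge0_integralZl//; last 2 first.
  + apply/measurable_EFinP; apply: measurable_funTS; apply: measurable_sum => g.
    exact: measurable_gaussian_pdf.
  + by move=> y _; rewrite lee_fin sumr_ge0// => g _; exact: gaussian_pdf_ge0.
  under [in RHS]eq_integral do rewrite -sumEFin.
  rewrite ge0_integral_sum// => g y _.
  by rewrite lee_fin gaussian_pdf_ge0.
- exact/measurable_EFinP.
Qed.

Definition lik_ratio th y : R := likelihood G y th / likelihood G y theta.

Lemma lratio_ge0 th y : 0 <= lik_ratio th y.
Proof. by rewrite divr_ge0 ?likelihood_ge0. Qed.

Lemma lratio_gt0 th y : 0 < lik_ratio th y.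
Proof. by rewrite divr_gt0 ?likelihood_gt0. Qed.

(* Weighting by the likelihood ratio turns expectations under the true law into
   expectations under the law of parameter [th]. *)
Lemma integral_tilt_lratio (t th : 'cV[R]_d) i :
  measurable_fun setT (lik_ratio th) ->
  (\int[P]_w (expR (dot t (Y i w) - dot t t / 2) * lik_ratio th (Y i w))%:E =
   (#|` G|%:R^-1 * \sum_(g <- G) expR (dot t (g *m th)))%:E)%E.
Proof.
move=> ml.
rewrite (integral_sample (h := fun y => expR (dot t y - dot t t / 2) * lik_ratio th y)); last 2 first.
- apply: measurable_funM => //; apply: measurableT_comp => //.
  by apply: measurable_funB => //; exact: measurable_dot.
- by move=> y; rewrite mulr_ge0 ?expR_ge0 ?lratio_ge0.
transitivity (\int[lebesgue_cV d]_y ((#|` G|%:R^-1)%:E *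
    \sum_(g <- G) (expR (dot t (g *m th)))%:E * (gaussian_pdf (g *m th + t) y)%:E))%E.
  apply: eq_integral => y _.
  rewrite /lik_ratio mulrA divfK ?gt_eqF ?likelihood_gt0//.
  rewrite likelihoodE mulrCA mulr_sumr EFinM -sumEFin; congr (_ * _)%E.
  by apply: eq_bigr => g _; rewrite gaussian_pdf_tilt EFinM.
have mg g : measurable_fun [set: 'cV[R]_d]
    (fun y => (gaussian_pdf (g *m th + t) y)%:E).
  by apply/measurable_EFinP; exact: measurable_gaussian_pdf.
rewrite ge0_integralZl//; last 2 first.
- by apply: emeasurable_sum => g; exact: measurable_funeM.
- move=> y _; apply: sume_ge0 => g _.
  by rewrite mule_ge0 ?lee_fin ?expR_ge0 ?gaussian_pdf_ge0.
rewrite EFinM -sumEFin ge0_integral_sum//; last 2 first.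
- by move=> g; exact: measurable_funeM.
- by move=> g y _; rewrite mule_ge0 ?lee_fin ?expR_ge0 ?gaussian_pdf_ge0.
congr (_ * _)%E; apply: eq_bigr => g _.
rewrite ge0_integralZl ?integral_gaussian_pdf ?mule1//.
by move=> y _; rewrite lee_fin gaussian_pdf_ge0.
Qed.

Lemma integrable_subexp (f : 'cV[R]_d -> R) i : subexp f ->
  integrableR P (fun w => f (Y i w)).
Proof.
move=> [mf [C [a [C0 a0 fa]]]].
have int_dot t : integrableR P (fun w => expR (dot t (Y i w))).
  have lr1 y : lik_ratio theta y = 1 by rewrite /lik_ratio divff// gt_eqF ?likelihood_gt0.
  have mh : measurable_fun setT (fun w => expR (dot t (Y i w) - dot t t / 2)).
    apply: measurableT_comp => //; apply: measurable_funB => //.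
    by apply: measurable_fun_dot.
  (* At the true parameter the ratio is 1, so the tilting formula becomes an explicit finite value
     for the exponential moment. *)
  have := @integral_tilt_lratio t theta i.
  rewrite (funext lr1) => /(_ (measurable_cst _)).
  under eq_integral do rewrite mulr1.
  move=> intE; suff : integrableR P (fun w => expR (dot t (Y i w) - dot t t / 2)).
    move=> /(integrableRZ (expR (dot t t / 2))).
    by under eq_fun do rewrite -expRD addrC subrK.
  apply/integrableP; split; first exact/measurable_EFinP.
  under eq_integral do rewrite gee0_abs ?lee_fin ?expR_ge0//.
  by rewrite intE ltry.
apply: (@integrableR_le _ _ _ _ _ (fun w => C * \sum_(j < d)
   (expR (dot ((a * d%:R) *: delta_mx j 0) (Y i w)) +
    expR (dot (- (a * d%:R) *: delta_mx j 0) (Y i w))))).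
- exact: (measurableT_comp mf).
- apply: integrableRZ; apply: integrableR_sum => j.
  by apply: integrableRD; exact: int_dot.
- move=> w; apply: le_trans (fa _) _; rewrite ler_wpM2l//.
  exact: expR_enorm_le.
Qed.

(** The observations share one law, so the observation of index 0 represents it; [Ex_sample]
    transfers the value to the other indices. *)
Definition expect0 (f : 'cV[R]_d -> R) : R := Ex P (fun w => f (Y 0%N w)).

Lemma Ex_sample (f : 'cV[R]_d -> R) i : subexp f -> Ex P (fun w => f (Y i w)) = expect0 f.
Proof.
move=> sf; have mf := subexp_measurable sf.
have mEf : measurable_fun [set: 'cV[R]_d] (EFin \o f) by exact/measurable_EFinP.
have key k : (\int[P]_w (f (Y k w))%:E =
    \int[distribution P (Y k)]_y (f y)%:E)%E.
  rewrite (@integral_distribution _ _ _ _ _ _ _ (EFin \o f))//.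
  exact: integrable_subexp.
congr fine; rewrite !key; apply: eq_measure_integral => A mA _.
by rewrite [LHS](lawY i mA) [RHS](lawY 0%N mA).
Qed.

End mixture_model.

(** * Empirical averages *)

Section empirical.
Context (R : realType) (d : nat) (d_gt0 : (0 < d)%N).
Context (G : {fset 'M[R]_d}) (isoG : isometry_group G) (theta : 'cV[R]_d).
Context (disp : measure_display) (T : measurableType disp).
Context (P : probability T R) (Y : nat -> {RV P >-> 'cV[R]_d}).
Hypothesis lawY : forall i (A : set 'cV[R]_d), measurable A ->
  distribution P (Y i) A = mixture_law G theta A.
Hypothesis indepY : mutually_independent Y.
Implicit Types f g : 'cV[R]_d -> R.

Local Notation E0 := (expect0 Y).
Local Notation sub_int := (integrable_subexp d_gt0 isoG lawY).
Local Notation sub_Ex := (Ex_sample d_gt0 isoG lawY).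

Definition emp_mean n f w : R := n%:R^-1 * \sum_(i < n) f (Y i w).

Definition emp_dev n f w : R := emp_mean n f w - E0 f.

Lemma mean_cst n (c : R) : (0 < n)%N -> n%:R^-1 * (\sum_(i < n) c) = c.
Proof.
move=> n0; rewrite sumr_const card_ord -[c *+ n]mulr_natl mulKf//.
by rewrite pnatr_eq0 -lt0n.
Qed.

Lemma integrable_emp n f : subexp f -> integrableR P (emp_mean n f).
Proof.
move=> sf; apply: integrableRZ; apply: integrableR_sum => i.
exact: sub_int.
Qed.

Lemma Ex_emp n f : (0 < n)%N -> subexp f -> Ex P (emp_mean n f) = E0 f.
Proof.
move=> n0 sf; rewrite /emp_mean ExZ; last first.
  by apply: integrableR_sum => i; exact: sub_int.
rewrite Ex_sum; last by move=> i; exact: sub_int.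
under eq_bigr do rewrite sub_Ex//.
exact: mean_cst.
Qed.

Lemma E0_cst c : E0 (fun=> c) = c.
Proof. exact: Ex_cst. Qed.

Lemma E0D f g : subexp f -> subexp g -> E0 (fun y => f y + g y) = E0 f + E0 g.
Proof. by move=> sf sg; rewrite /expect0 ExD//; exact: sub_int. Qed.

Lemma E0B f g : subexp f -> subexp g -> E0 (fun y => f y - g y) = E0 f - E0 g.
Proof. by move=> sf sg; rewrite /expect0 ExB//; exact: sub_int. Qed.

Lemma E0Z c f : subexp f -> E0 (fun y => c * f y) = c * E0 f.
Proof. by move=> sf; rewrite /expect0 ExZ//; exact: sub_int. Qed.

Lemma E0_sum (I : Type) (s : seq I) (F : I -> 'cV[R]_d -> R) :
  (forall i, subexp (F i)) ->
  E0 (fun y => \sum_(i <- s) F i y) = \sum_(i <- s) E0 (F i).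
Proof. by move=> sF; rewrite /expect0 Ex_sum// => i; exact: sub_int. Qed.

Lemma E0_le f g : subexp f -> subexp g -> (forall y, f y <= g y) -> E0 f <= E0 g.
Proof. by move=> sf sg fg; rewrite /expect0 Ex_le//; exact: sub_int. Qed.

Lemma E0_ge0 f : (forall y, 0 <= f y) -> 0 <= E0 f.
Proof. by move=> f0; exact: Ex_ge0. Qed.

Lemma E0_norm f : subexp f -> `|E0 f| <= E0 (fun y => `|f y|).
Proof. by move=> sf; apply: Ex_norm_le; exact: sub_int. Qed.

Lemma empD n f g w : emp_mean n (fun y => f y + g y) w = emp_mean n f w + emp_mean n g w.
Proof. by rewrite /emp_mean big_split /= mulrDr. Qed.

Lemma empZ n c f w : emp_mean n (fun y => c * f y) w = c * emp_mean n f w.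
Proof. by rewrite /emp_mean -mulr_sumr mulrCA. Qed.

Lemma empB n f g w : emp_mean n (fun y => f y - g y) w = emp_mean n f w - emp_mean n g w.
Proof. by rewrite /emp_mean sumrB mulrBr. Qed.

Lemma emp_cst n c w : (0 < n)%N -> emp_mean n (fun=> c) w = c.
Proof. exact: mean_cst. Qed.

Lemma emp_sum (I : Type) (s : seq I) (F : I -> 'cV[R]_d -> R) n w :
  emp_mean n (fun y => \sum_(i <- s) F i y) w = \sum_(i <- s) emp_mean n (F i) w.
Proof. by rewrite /emp_mean exchange_big /= mulr_sumr. Qed.

Lemma emp_le n f g w : (forall y, f y <= g y) -> emp_mean n f w <= emp_mean n g w.
Proof. by move=> fg; rewrite /emp_mean ler_wpM2l ?invr_ge0// ler_sum. Qed.

Lemma emp_norm n f w : `|emp_mean n f w| <= emp_mean n (fun y => `|f y|) w.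
Proof.
rewrite /emp_mean normrM normfV (ger0_norm (ler0n _ n)) ler_wpM2l ?invr_ge0//.
exact: ler_norm_sum.
Qed.

Lemma emp_ge0 n f w : (forall y, 0 <= f y) -> 0 <= emp_mean n f w.
Proof. by move=> f0; rewrite mulr_ge0 ?invr_ge0// sumr_ge0. Qed.

Lemma emp_cauchy_schwarz n f g w :
  emp_mean n (fun y => f y * g y) w ^+ 2 <=
  emp_mean n (fun y => f y ^+ 2) w * emp_mean n (fun y => g y ^+ 2) w.
Proof.
rewrite /emp_mean exprMn [leRHS]mulrACA -[n%:R^-1 * _]expr2 ler_wpM2l ?sqr_ge0//.
exact: sqr_sum_mul_le.
Qed.

Lemma devD n f g w : subexp f -> subexp g ->
  emp_dev n (fun y => f y + g y) w = emp_dev n f w + emp_dev n g w.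
Proof. by move=> sf sg; rewrite /emp_dev empD E0D//; ring. Qed.

Lemma devZ n c f w : subexp f -> emp_dev n (fun y => c * f y) w = c * emp_dev n f w.
Proof. by move=> sf; rewrite /emp_dev empZ E0Z//; ring. Qed.

Lemma dev_cst n c w : (0 < n)%N -> emp_dev n (fun=> c) w = 0.
Proof. by move=> n0; rewrite /emp_dev emp_cst// E0_cst subrr. Qed.

Lemma dev_sum (I : Type) (s : seq I) (F : I -> 'cV[R]_d -> R) n w :
  (forall i, subexp (F i)) ->
  emp_dev n (fun y => \sum_(i <- s) F i y) w = \sum_(i <- s) emp_dev n (F i) w.
Proof. by move=> sF; rewrite /emp_dev emp_sum E0_sum// -sumrB. Qed.

Lemma dev_le n f g w : subexp f -> subexp g -> (forall y, `|f y| <= g y) ->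
  `|emp_dev n f w| <= emp_mean n g w + E0 g.
Proof.
move=> sf sg fg; apply: le_trans (ler_normB _ _) _; apply: lerD.
  by apply: le_trans (emp_norm _ _ _) _; exact: emp_le.
apply: le_trans (E0_norm sf) _; apply: E0_le => //.
exact: subexp_norm.
Qed.

Lemma integrable_dev n f : subexp f -> integrableR P (emp_dev n f).
Proof.
move=> sf; apply: integrableRD; last exact: integrableR_cst.
exact: integrable_emp.
Qed.

(** After centring, independence kills the off-diagonal terms of the double sum, and the variance
    left on the diagonal is at most the second moment. *)
Lemma Ex_sqr_dev n f : (0 < n)%N -> subexp f ->
  integrableR P (fun w => emp_dev n f w ^+ 2) /\
  Ex P (fun w => emp_dev n f w ^+ 2) <= E0 (fun y => f y ^+ 2) / n%:R.
Proof.
move=> n0 sf; pose h y := f y - E0 f.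
have nN0 : n%:R != 0 :> R by rewrite pnatr_eq0 -lt0n.
have sh : subexp h by apply: subexpB => //; exact: subexp_cst.
have mh := subexp_measurable sh.
have Eh : E0 h = 0 by rewrite E0B ?E0_cst ?subrr//; exact: subexp_cst.
have devE w : emp_dev n f w ^+ 2 =
    n%:R^-1 ^+ 2 * \sum_(i < n) \sum_(j < n) h (Y i w) * h (Y j w).
  rewrite /emp_dev /emp_mean.
  rewrite -{1}(mean_cst (E0 f) n0).
  rewrite -mulrBr -sumrB exprMn; congr (_ * _).
  by rewrite expr2 mulr_suml; apply: eq_bigr => i _; rewrite mulr_sumr.
have int_hh i j : integrableR P (fun w => h (Y i w) * h (Y j w)).
  apply: (@integrableR_le _ _ _ _ _
      (fun w => h (Y i w) ^+ 2 + h (Y j w) ^+ 2)).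
  - by apply: measurable_funM; exact: (measurableT_comp mh).
  - by apply: integrableRD; [exact: (sub_int i (subexpX 2 sh))|exact: (sub_int j (subexpX 2 sh))].
  - move=> w; rewrite normrM -[h (Y i w) ^+ 2]real_normK ?num_real//.
    rewrite -[h (Y j w) ^+ 2]real_normK ?num_real//.
    by have := normr_ge0 (h (Y i w)); have := normr_ge0 (h (Y j w)); nra.
have Ehh i j : Ex P (fun w => h (Y i w) * h (Y j w)) =
    (i == j)%:R * E0 (fun y => h y ^+ 2).
  have [->|ij] := eqVneq i j.
    by rewrite mul1r -(sub_Ex (f := fun y => h y ^+ 2) j)//; exact: subexpX.
  rewrite mul0r (@Ex_mul_indep _ _ _ _ _ _ _ _ (Y i) (Y j))//.
  - by rewrite [X in X * _](sub_Ex i sh) Eh mul0r.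
  - move=> A B mA mB.
    (* Pairwise independence is the instance for the index set {i, j}, with the event [A] at i and
       [B] at j. *)
    have := indepY (J := [fset i; j]%fset) (A := fun k => if k == i then A else B).
    rewrite big_fsetU1 ?inE//= big_seq_fset1 eqxx eq_sym (negbTE ij).
    move=> /(_ _)<-; last by move=> k _; case: ifP.
    congr (P _); apply/seteqP; split=> w /=.
      move=> [Aw Bw] k; rewrite /= !inE => /orP[] /eqP ->; rewrite ?eqxx//.
      by rewrite eq_sym (negbTE ij).
    move=> H; split; first by have := H i; rewrite eqxx; apply; rewrite /= !inE eqxx.
    by have := H j; rewrite eq_sym (negbTE ij); apply; rewrite /= !inE eqxx orbT.
  - exact: (sub_int i sh).
  - exact: (sub_int j sh).
have int_sum : integrableR P (fun w => \sum_(i < n) \sum_(j < n) h (Y i w) * h (Y j w)).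
  by apply: integrableR_sum => i; exact: integrableR_sum.
under eq_fun do rewrite devE.
split; first exact: integrableRZ.
rewrite ExZ// Ex_sum; last by move=> i; exact: integrableR_sum.
rewrite (eq_bigr (fun=> E0 (fun y => h y ^+ 2))); last first.
  move=> i _; rewrite Ex_sum// (bigD1 i)//= Ehh eqxx mul1r big1 ?addr0//.
  by move=> j ji; rewrite Ehh val_eqE eq_sym (negbTE ji) mul0r.
rewrite sumr_const card_ord -[X in _ * X]mulr_natl mulrA expr2 mulfVK//.
rewrite mulrC ler_wpM2r ?invr_ge0//.
have -> : E0 (fun y => h y ^+ 2) =
   E0 (fun y => f y ^+ 2 - ((2 * E0 f) * f y - E0 f ^+ 2)).
  by congr E0; apply/funext => y; rewrite /h; ring.
have s1 : subexp (fun y => 2 * E0 f * f y) by exact: subexpZ.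
have s2 := subexp_cst (d := d) (E0 f ^+ 2).
have s3 := subexpB s1 s2.
rewrite (E0B (subexpX 2 sf) s3) (E0B s1 s2) E0Z// E0_cst.
by have := sqr_ge0 (E0 f); nra.
Qed.

(** The pointwise bound |x| <= x^2 / (2 a) + a / 2 at a = W / sqrt n replaces Cauchy-Schwarz for
    expectations; both terms then have mean at most a / 2. *)
Lemma Ex_norm_dev n f W : (0 < n)%N -> subexp f -> 0 < W ->
  E0 (fun y => f y ^+ 2) <= W ^+ 2 ->
  Ex P (fun w => `|emp_dev n f w|) <= W / Num.sqrt n%:R.
Proof.
move=> n0 sf W0 fW; have [int2 le2] := Ex_sqr_dev n0 sf.
have sn : 0 < Num.sqrt n%:R :> R by rewrite sqrtr_gt0 ltr0n.
set a := W / _; have a0 : 0 < a by rewrite divr_gt0.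
have int_b : integrableR P (fun w => (2 * a)^-1 * emp_dev n f w ^+ 2 + a / 2).
  by apply: integrableRD; [exact: integrableRZ|exact: integrableR_cst].
apply: (@le_trans _ _ (Ex P (fun w => (2 * a)^-1 * emp_dev n f w ^+ 2 + a / 2))).
  apply: Ex_le => //; first by apply: integrableR_norm; exact: integrable_dev.
  move=> w; rewrite -[emp_dev n f w ^+ 2]real_normK ?num_real//.
  rewrite -subr_ge0 (_ : _ - _ = (2 * a)^-1 * (`|emp_dev n f w| - a) ^+ 2).
    by rewrite mulr_ge0 ?sqr_ge0// invr_ge0 mulr_ge0// ltW.
  by field; rewrite gt_eqF.
have int_z : integrableR P (fun w => (2 * a)^-1 * emp_dev n f w ^+ 2).
  exact: integrableRZ.
have int_c : integrableR P (fun=> a / 2) by exact: integrableR_cst.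
rewrite (ExD int_z int_c) ExZ// Ex_cst.
have h : Ex P (fun w => emp_dev n f w ^+ 2) <= a ^+ 2.
  apply: le_trans le2 _; rewrite /a expr_div_n sqr_sqrtr//.
  by rewrite ler_wpM2r ?invr_ge0.
apply: (@le_trans _ _ ((2 * a)^-1 * a ^+ 2 + a / 2)).
  by rewrite lerD2r ler_wpM2l// invr_ge0 mulr_ge0// ltW.
by rewrite le_eqVlt; apply/orP; left; apply/eqP; field; rewrite gt_eqF.
Qed.

End empirical.

(** * Expansion of the likelihood ratio *)

Section likelihood_ratio.
Context (R : realType) (d : nat).
Context (G : {fset 'M[R]_d}) (isoG : isometry_group G) (theta : 'cV[R]_d).
Implicit Types (g h : 'M[R]_d) (y z dl : 'cV[R]_d).

Local Notation H := (stabilizer G theta).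
Local Notation Hbar := (mx_average H).

Lemma stabP h : reflect (h \in G /\ h *m theta = theta) (h \in H).
Proof. by rewrite !inE; apply: (iffP andP) => -[hG /eqP]. Qed.

Lemma cardH_gt0 : 0 < #|` H|%:R :> R.
Proof.
rewrite ltr0n cardfs_gt0; apply/fset0Pn; exists 1%:M; apply/stabP.
by rewrite mul1mx; split=> //; exact: iso1.
Qed.

Lemma averageE z : Hbar *m z = #|` H|%:R^-1 *: \sum_(h <- H) (h *m z).
Proof. by rewrite /mx_average -scalemxAl mulmx_suml. Qed.

Lemma dot_average x z : (forall h, h \in H -> dot x (h *m z) = dot x z) ->
  dot x (Hbar *m z) = dot x z.
Proof.
move=> hx; rewrite averageE dotZr dot_sumr.
rewrite (eq_big_seq (fun=> dot x z)); last by move=> h /hx.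
rewrite big_const_seq count_predT iter_addr_0 -[dot _ _ *+ _]mulr_natl mulKf//.
by rewrite gt_eqF ?cardH_gt0.
Qed.

Lemma dot_theta_average z : dot theta (Hbar *m z) = dot theta z.
Proof.
apply: dot_average => h /stabP[hG hth].
by rewrite -{1}hth (iso_dot isoG).
Qed.

Lemma enorm_average z : enorm (Hbar *m z) <= enorm z.
Proof.
rewrite averageE enormZ ger0_norm ?invr_ge0// ler_pdivrMl ?cardH_gt0//.
apply: le_trans (enorm_sum _ _) _.
rewrite (eq_big_seq (fun=> enorm z)); last first.
  by move=> h /stabP[hG _]; rewrite (iso_enorm isoG).
by rewrite big_const_seq count_predT iter_addr_0 [leRHS]mulr_natl.
Qed.

(** For g in [G], the posterior probability of the component g theta given y: isometries keep |g
    theta| constant, so the Gaussian densities reduce to these exponentials. Written as a single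
    exponential, its positivity and its comparison with exp <g theta - theta, y> are immediate. *)
Definition wt g y : R :=
  expR (dot (g *m theta) y - ln (\sum_(h <- G) expR (dot (h *m theta) y))).

Lemma partition_ge y : expR (dot theta y) <=
  \sum_(h <- G) expR (dot (h *m theta) y).
Proof.
rewrite (big_fsetD1 1%:M)/=; last exact: iso1.
by rewrite mul1mx lerDl sumr_ge0// => g _; exact: expR_ge0.
Qed.

Lemma partition_gt0 y : 0 < \sum_(h <- G) expR (dot (h *m theta) y).
Proof. exact: lt_le_trans (expR_gt0 _) (partition_ge y). Qed.

Lemma wtE g y : wt g y =
  expR (dot (g *m theta) y) / \sum_(h <- G) expR (dot (h *m theta) y).
Proof. by rewrite /wt expRD expRN lnK// posrE partition_gt0. Qed.

Lemma wt_ge0 g y : 0 <= wt g y. Proof. exact: expR_ge0. Qed.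

Lemma sum_wt y : \sum_(g <- G) wt g y = 1.
Proof.
under eq_bigr do rewrite wtE.
by rewrite -mulr_suml divff// gt_eqF ?partition_gt0.
Qed.

(** For g in [G] the weight is at most 1, but [subexp_sum] asks for every matrix g. Keeping only the
    identity term of the denominator gives an exponential bound for all of them. *)
Lemma subexp_wt g : subexp (wt g).
Proof.
apply: (subexp_le _ (subexp_expR_dot (g *m theta - theta))).
  apply: measurableT_comp => //; apply: measurable_funB; first exact: measurable_dot.
  apply: (measurableT_comp (@measurable_ln R)).
  by apply: measurable_sum => h; apply: measurableT_comp => //; exact: measurable_dot.
move=> y; rewrite !ger0_norm ?expR_ge0// ler_expR dotDl dotNl lerD2l lerN2.
by rewrite -[leLHS]expRK ler_ln ?posrE ?expR_gt0 ?partition_gt0 ?partition_ge.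
Qed.

Lemma wt_sum_le y (F : 'M[R]_d -> R) c : (forall g, g \in G -> `|F g| <= c) ->
  `|\sum_(g <- G) wt g y * F g| <= c.
Proof.
move=> Fc; apply: le_trans (ler_norm_sum _ _ _) _.
rewrite -[leRHS]mul1r -(sum_wt y) mulr_suml !big_seq; apply: ler_sum => g gG.
by rewrite normrM ger0_norm ?wt_ge0// ler_wpM2l ?wt_ge0 ?Fc.
Qed.

Definition tilt_sum dl y : R := \sum_(g <- G) wt g y * expR (dot (g *m dl) y).

Definition tilt_cst dl : R := expR (- dot theta dl - dot dl dl / 2).

(** As |g th| = |th|, the quadratic terms leave the sums over [G]. What remains is a deterministic
    factor times a posterior mean of exponentials, and only the latter fluctuates with the
    sample. *)
Lemma lratioE dl y :
  lik_ratio G theta (theta + dl) y = tilt_cst dl * tilt_sum dl y.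
Proof.
have likE th : likelihood G y th =
    (#|` G|%:R * (2 * pi) `^ (d%:R / 2))^-1 * expR (- (dot y y / 2)) *
    expR (- (dot th th / 2)) * \sum_(g <- G) expR (dot (g *m th) y).
  rewrite /likelihood -!mulrA; congr (_ * _).
  rewrite !mulr_sumr !big_seq; apply: eq_bigr => g gG.
  rewrite sqr_enorm -!expRD; congr expR.
  rewrite !(dotDl, dotDr, dotNl, dotNr) (iso_dot isoG)// (dotC y (g *m th)).
  by field.
rewrite /lik_ratio !likE; set c := _^-1 * _.
have c0 : c != 0.
  rewrite mulf_neq0 ?expR_eq0// invr_neq0// mulf_neq0 ?gt_eqF ?powR_gt0 ?mulr_gt0 ?pi_gt0//.
  exact: cardG_gt0.
rewrite /tilt_cst /tilt_sum.
have -> : \sum_(g <- G) wt g y * expR (dot (g *m dl) y) =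
    (\sum_(g <- G) expR (dot (g *m (theta + dl)) y)) /
    (\sum_(g <- G) expR (dot (g *m theta) y)).
  rewrite mulr_suml; apply: eq_bigr => g _.
  by rewrite wtE mulrAC -expRD -dotDl -mulmxDr.
have -> : - dot theta dl - dot dl dl / 2 =
    - (dot (theta + dl) (theta + dl) / 2) + dot theta theta / 2.
  by rewrite !(dotDl, dotDr) (dotC dl theta); field.
rewrite expRD -[expR (dot theta theta / 2)]invrK -expRN.
field; rewrite c0 expR_eq0 gt_eqF ?partition_gt0//.
Qed.

Definition taylor_term k dl y : R :=
  \sum_(g <- G) wt g y * (dot (g *m dl) y ^+ k / k`!%:R).

Lemma taylor0 dl y : taylor_term 0 dl y = 1.
Proof.
rewrite /taylor_term -[RHS](sum_wt y); apply: eq_bigr => g _.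
by rewrite expr0 fact0 divr1 mulr1.
Qed.

(* The weights are invariant under right multiplication by the stabilizer, so
   the first-order term only sees the component fixed by it. *)
Lemma taylor1_average dl y : taylor_term 1 dl y = taylor_term 1 (Hbar *m dl) y.
Proof.
have tE z : taylor_term 1 z y = dot (\sum_(g <- G) wt g y *: (g^T *m y)) z.
  rewrite dotC dot_sumr; apply: eq_bigr => g _.
  by rewrite expr1 (_ : 1`! = 1)%N// divr1 dotZr dot_mulmx.
rewrite !tE dot_average// => h /stabP[hG hth]; rewrite -!tE /taylor_term.
rewrite -[RHS](sum_iso_mulr isoG
  (fun g => wt g y * (dot (g *m dl) y ^+ 1 / 1`!%:R)) hG).
by apply: eq_bigr => g _; rewrite /wt -!(mulmxA g h) hth.
Qed.

(** Coefficient of a monomial in the coordinates of dl, indexed by ordered multi-indices. There are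
    d^k of them at order k and none depends on dl, so a bound on these finitely many averages is
    uniform in dl. *)
Definition taylor_coefficient k (f : {ffun 'I_k -> 'I_d}) y : R :=
  \sum_(g <- G) wt g y * \prod_(l < k) dot (g *m delta_mx (f l) 0) y.

Lemma taylor_expand k dl y : taylor_term k dl y =
  \sum_(f : {ffun 'I_k -> 'I_d})
    (\prod_(l < k) dl (f l) 0) / k`!%:R * taylor_coefficient f y.
Proof.
have dotE g : dot (g *m dl) y = \sum_(j < d) dl j 0 * dot (g *m delta_mx j 0) y.
  have {1}-> : dl = \sum_j dl j 0 *: delta_mx j 0 :> 'cV_d.
    rewrite [LHS]matrix_sum_delta; apply: eq_bigr => i _.
    by rewrite big_ord1.
  rewrite mulmx_sumr dotC dot_sumr; apply: eq_bigr => j _.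
  by rewrite -scalemxAr dotZr dotC.
rewrite /taylor_coefficient; under [RHS]eq_bigr do rewrite mulr_sumr.
rewrite exchange_big; apply: eq_bigr => g _ /=.
rewrite dotE (_ : (\sum_j _) ^+ k = \prod_(l < k)
    \sum_j dl j 0 * dot (g *m delta_mx j 0) y); last by rewrite prodr_const card_ord.
rewrite bigA_distr_bigA /= mulr_suml mulr_sumr; apply: eq_bigr => f _.
by rewrite big_split /=; ring.
Qed.

Lemma subexp_taylor_coef k (f : {ffun 'I_k -> 'I_d}) : subexp (taylor_coefficient f).
Proof.
apply: subexp_sum => g; apply: subexpM; first exact: subexp_wt.
by apply: subexp_prod => l; exact: subexp_dot.
Qed.

Lemma subexp_taylor k dl : subexp (taylor_term k dl).
Proof.
apply: subexp_sum => g; apply: subexpM; first exact: subexp_wt.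
apply: subexpM; last exact: subexp_cst.
by apply: subexpX; exact: subexp_dot.
Qed.

Lemma subexp_tiltsum dl : subexp (tilt_sum dl).
Proof.
apply: subexp_sum => g; apply: subexpM; first exact: subexp_wt.
exact: subexp_expR_dot.
Qed.

Lemma dot_iso_le g z y : g \in G -> `|dot (g *m z) y| <= enorm z * enorm y.
Proof. by move=> gG; rewrite (le_trans (dot_le _ _))// (iso_enorm isoG). Qed.

Lemma taylor_coef_le k (f : {ffun 'I_k -> 'I_d}) y :
  `|taylor_coefficient f y| <= enorm y ^+ k.
Proof.
apply: wt_sum_le => g gG; rewrite normr_prod.
rewrite (_ : enorm y ^+ k = \prod_(l < k) enorm y); last first.
  by rewrite prodr_const card_ord.
apply: ler_prod => l _.
rewrite normr_ge0 (le_trans (dot_iso_le _ _ gG))//.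
by rewrite enorm_dot dot_delta mxE !eqxx sqrtr1 mul1r.
Qed.

Lemma tiltsum_taylor K dl y : `|tilt_sum dl y - \sum_(k < K) taylor_term k dl y| <=
  (enorm dl * enorm y) ^+ K / K`!%:R * expR (enorm dl * enorm y).
Proof.
rewrite /taylor_term exchange_big /= /tilt_sum -sumrB.
under eq_bigr do rewrite -mulr_sumr -mulrBr.
apply: wt_sum_le => g gG; apply: le_trans (expR_tail _ _) _.
have h := dot_iso_le dl y gG.
rewrite ler_pM ?ler_expR ?expR_ge0 ?divr_ge0 ?exprn_ge0//.
by rewrite ler_wpM2r ?invr_ge0// lerXn2r ?nnegrE ?mulr_ge0 ?enorm_ge0.
Qed.

Lemma tiltsum_le dl y : `|tilt_sum dl y| <= expR (enorm dl * enorm y).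
Proof.
apply: wt_sum_le => g gG; rewrite ger0_norm ?expR_ge0// ler_expR.
exact: le_trans (ler_norm _) (dot_iso_le _ _ gG).
Qed.

Lemma tiltsum_ge0 dl y : 0 <= tilt_sum dl y.
Proof. by apply: sumr_ge0 => g _; rewrite mulr_ge0 ?expR_ge0. Qed.

End likelihood_ratio.

(** * Uniform fluctuations *)

Section fluctuation.
Context (R : realType) (d : nat) (d_gt0 : (0 < d)%N).
Context (G : {fset 'M[R]_d}) (isoG : isometry_group G) (theta : 'cV[R]_d).
Context (disp : measure_display) (T : measurableType disp).
Context (P : probability T R) (Y : nat -> {RV P >-> 'cV[R]_d}).
Hypothesis lawY : forall i (A : set 'cV[R]_d), measurable A ->
  distribution P (Y i) A = mixture_law G theta A.
Hypothesis indepY : mutually_independent Y.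

Local Notation E0 := (expect0 Y).
Local Notation emp := (emp_mean Y).
Local Notation dev := (emp_dev Y).
Local Notation Hbar := (mx_average (stabilizer G theta)).
Local Notation tiltsum := (tilt_sum G theta).
Local Notation taylor := (taylor_term G theta).
Local Notation taylor_coef := (taylor_coefficient G theta).

Section bounds.
Variables (psi : 'cV[R]_d -> R) (D : R).
Hypotheses (spsi : subexp psi) (D1 : 1 <= D).

Let D0 : 0 < D. Proof. exact: lt_le_trans D1. Qed.

(** The factor D^k / k! is moved into the coefficient so that dl enters only through (|dl| / D)^k, a
    quantity at most 1 on the ball. *)
Let coefpsi k (f : {ffun 'I_k -> 'I_d}) y :=
  (D ^+ k / k`!%:R * taylor_coef f y) * psi y.

Let envpsi K y :=
  ((D * enorm y) ^+ K / K`!%:R * expR (D * enorm y)) * `|psi y|.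

Let devsum n k w := \sum_(f : {ffun 'I_k -> 'I_d}) `|dev n (coefpsi f) w|.

Let scoef k (f : {ffun 'I_k -> 'I_d}) : subexp (coefpsi f).
Proof.
by apply: subexpM => //; apply: subexpZ; exact: subexp_taylor_coef.
Qed.

Let senv K : subexp (envpsi K).
Proof.
apply: subexpM; last exact: subexp_norm.
apply: subexpM; last by apply: subexp_expR_enorm; exact: ltW.
apply: subexpM; last exact: subexp_cst.
by apply: subexpX; apply: subexpZ; exact: subexp_enorm.
Qed.

Let dev_taylor n k dl w :
  `|dev n (fun y => taylor k dl y * psi y) w| <= (enorm dl / D) ^+ k * devsum n k w.
Proof.
have -> : (fun y => taylor k dl y * psi y) = (fun y =>
    \sum_(f : {ffun 'I_k -> 'I_d}) (\prod_(l < k) dl (f l) 0) / D ^+ k * coefpsi f y).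
  apply/funext => y; rewrite taylor_expand mulr_suml; apply: eq_bigr => f _.
  rewrite /coefpsi; field.
  by rewrite pnatr_eq0 -lt0n fact_gt0 expf_neq0// gt_eqF.
rewrite (dev_sum d_gt0 isoG lawY); last by move=> f; exact: subexpZ.
apply: le_trans (ler_norm_sum _ _ _) _; rewrite mulr_sumr.
apply: ler_sum => f _; rewrite (devZ d_gt0 isoG lawY)// normrM ler_wpM2r//.
have Dk : 0 <= D ^+ k by rewrite exprn_ge0 ?(ltW D0).
rewrite expr_div_n normrM normfV (ger0_norm Dk).
rewrite ler_wpM2r ?invr_ge0 ?exprn_ge0 ?(ltW D0)// normr_prod.
rewrite (_ : enorm dl ^+ k = \prod_(l < k) enorm dl); last first.
  by rewrite prodr_const card_ord.
by apply: ler_prod => l _; rewrite normr_ge0 le_enorm.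
Qed.

(** As |dl| / D <= 1, orders above two are no worse than order two, and D >= 1 then removes the
    denominator. *)
Let ratio_le k (dl : 'cV[R]_d) : (1 < k)%N -> enorm dl <= D ->
  (enorm dl / D) ^+ k <= enorm dl ^+ 2.
Proof.
move=> k1 dlD; have q0 : 0 <= enorm dl / D by rewrite divr_ge0 ?enorm_ge0 ?ltW.
have q1 : enorm dl / D <= 1 by rewrite ler_pdivrMr ?mul1r.
apply: (@le_trans _ _ ((enorm dl / D) ^+ 2)).
  by rewrite ler_wiXn2l.
rewrite lerXn2r ?nnegrE ?enorm_ge0// ler_pdivrMr//.
by rewrite ler_peMr ?enorm_ge0.
Qed.

Let taylor_rem_le k (dl y : 'cV[R]_d) : (1 < k)%N -> enorm dl <= D ->
  (enorm dl * enorm y) ^+ k / k`!%:R * expR (enorm dl * enorm y) <=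
  enorm dl ^+ 2 * ((D * enorm y) ^+ k / k`!%:R * expR (D * enorm y)).
Proof.
move=> k1 dlD; have Dy : 0 <= D * enorm y by rewrite mulr_ge0 ?enorm_ge0 ?ltW.
have -> : (enorm dl * enorm y) ^+ k = (enorm dl / D) ^+ k * (D * enorm y) ^+ k.
  by rewrite -exprMn mulrA mulfVK// gt_eqF.
set p := (D * enorm y) ^+ k; have p0 : 0 <= p by exact: exprn_ge0.
rewrite -2!mulrA; apply: ler_pM.
- by rewrite exprn_ge0// divr_ge0 ?enorm_ge0 ?ltW.
- by rewrite mulr_ge0// mulr_ge0 ?invr_ge0 ?expR_ge0.
- exact: ratio_le.
- by rewrite mulrA ler_wpM2l ?divr_ge0// ler_expR ler_wpM2r ?enorm_ge0.
Qed.

Let devsum_ge0 n k w : 0 <= devsum n k w.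
Proof. by apply: sumr_ge0 => f _; exact: normr_ge0. Qed.

Let env_ge0 K y : 0 <= envpsi K y.
Proof.
rewrite mulr_ge0// mulr_ge0 ?expR_ge0// divr_ge0// exprn_ge0//.
by rewrite mulr_ge0 ?enorm_ge0// ltW.
Qed.

(** Order 0 is the constant 1 and cancels with the subtracted deviation, order 1 is controlled by
    |Hbar dl|, and each further order by |dl|^2. Stopping at K + 2 makes the remainder at least
    quadratic too. *)
Let dev_tiltsum n K dl w : (0 < n)%N -> enorm dl <= D ->
  `|dev n (fun y => tiltsum dl y * psi y) w - dev n psi w| <=
  (\sum_(k < K.+2) devsum n k w + (emp n (envpsi K.+2) w + E0 (envpsi K.+2))) *
  (enorm (Hbar *m dl) + enorm dl ^+ 2).
Proof.
move=> n0 dlD; set r := _ + enorm dl ^+ 2.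
have u0 := enorm_ge0 (Hbar *m dl).
have r2 : enorm dl ^+ 2 <= r by rewrite lerDr.
pose rem y := (tiltsum dl y - \sum_(k < K.+2) taylor k dl y) * psi y.
have staylor k z : subexp (fun y => taylor k z y * psi y).
  by apply: subexpM => //; exact: subexp_taylor.
have srem : subexp rem.
  apply: subexpM => //; apply: subexpB; first exact: subexp_tiltsum.
  by apply: subexp_sum => k; exact: subexp_taylor.
have -> : (fun y => tiltsum dl y * psi y) =
    (fun y => \sum_(k < K.+2) taylor k dl y * psi y + rem y).
  by apply/funext => y; rewrite /rem -mulr_suml; ring.
rewrite (devD d_gt0 isoG lawY)//; last by apply: subexp_sum => k; exact: staylor.
rewrite (dev_sum d_gt0 isoG lawY)//.
rewrite big_ord_recl /= [X in X + _ + _ + _](_ : _ = dev n psi w); last first.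
  by congr (dev n _ w); apply/funext => y; rewrite taylor0// mul1r.
rewrite [X in `|X|](_ : _ = \sum_(i < K.+1)
    dev n (fun y => taylor (lift ord0 i) dl y * psi y) w + dev n rem w); last by ring.
apply: le_trans (ler_normD _ _) _; rewrite mulrDl; apply: lerD.
  rewrite [X in _ <= X * _]big_ord_recl /= mulrDl ler_wpDl ?mulr_ge0 ?devsum_ge0 ?addr_ge0 ?sqr_ge0//.
  apply: le_trans (ler_norm_sum _ _ _) _; rewrite mulr_suml; apply: ler_sum => i _.
  rewrite /= /bump /= add1n [leRHS]mulrC; case: (posnP i) => [->|i0].
    rewrite (_ : (fun y => _) = (fun y => taylor 1 (Hbar *m dl) y * psi y)); last first.
      by apply/funext => y; rewrite taylor1_average.
    apply: le_trans (dev_taylor _ _ _ _) _; rewrite expr1 ler_wpM2r//.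
    apply: (@le_trans _ _ (enorm (Hbar *m dl))).
      by rewrite ler_pdivrMr// ler_peMr.
    by rewrite lerDl sqr_ge0.
  apply: le_trans (dev_taylor _ _ _ _) _; rewrite ler_wpM2r//.
  exact: le_trans (ratio_le _ dlD) r2.
apply: (@le_trans _ _ (enorm dl ^+ 2 * (emp n (envpsi K.+2) w + E0 (envpsi K.+2)))).
  rewrite mulrDr -empZ -(E0Z d_gt0 isoG lawY)//.
  apply: (dev_le d_gt0 isoG lawY) => //; first exact: subexpZ.
  move=> y; rewrite /rem normrM /envpsi [leRHS]mulrA ler_wpM2r//.
  apply: le_trans (tiltsum_taylor isoG _ _ _ _) _.
  exact: taylor_rem_le.
rewrite [leRHS]mulrC ler_wpM2r//.
by rewrite addr_ge0 ?emp_ge0 ?E0_ge0.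
Qed.

(** The bound x^k / k! <= c^-k exp (c x), at x = D |y| and c = 2 d, gives (2 d)^-k per coefficient,
    hence 2^-k for the d^k coefficients of order k. In [V], the exponent 3 D is 2 D from c = 2 plus
    D from the exponential of the remainder. Adding 1 makes [W] positive, as [Ex_norm_dev]
    requires. *)
Let W := Num.sqrt (E0 (fun y => (expR (2 * d%:R * D * enorm y) * `|psi y|) ^+ 2)) + 1.
Let V := E0 (fun y => expR (3 * D * enorm y) * `|psi y|).

Let pow_fact_le (c x : R) k : 0 < c -> 0 <= x ->
  x ^+ k / k`!%:R <= c^-1 ^+ k * expR (c * x).
Proof.
move=> c0 x0; apply: (@le_trans _ _ (c^-1 ^+ k * ((c * x) ^+ k / k`!%:R))).
  by rewrite exprMn !mulrA -exprMn mulVf ?gt_eqF// expr1n mul1r.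
rewrite ler_wpM2l ?exprn_ge0 ?invr_ge0 ?(ltW c0)//.
by apply: exprn_le_expR; rewrite mulr_ge0// ltW.
Qed.

Let Ex_coef n k (f : {ffun 'I_k -> 'I_d}) : (0 < n)%N ->
  Ex P (fun w => `|dev n (coefpsi f) w|) <=
  (2 * d%:R)^-1 ^+ k * W / Num.sqrt n%:R.
Proof.
move=> n0; have dd : 0 < 2 * d%:R :> R by rewrite mulr_gt0 ?ltr0n.
have W0 : 0 < W by rewrite ltr_wpDl ?sqrtr_ge0.
apply: (Ex_norm_dev d_gt0 isoG lawY) => //.
  by rewrite mulr_gt0// exprn_gt0// invr_gt0.
set h := fun y => (expR (2 * d%:R * D * enorm y) * `|psi y|) ^+ 2.
have sh : subexp h.
  apply: subexpX; apply: subexpM; last exact: subexp_norm.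
  by apply: subexp_expR_enorm; rewrite mulr_ge0 ?(ltW D0) ?(ltW dd).
apply: (@le_trans _ _ (E0 (fun y => (2 * d%:R)^-1 ^+ k ^+ 2 * h y))).
  apply: (E0_le d_gt0 isoG lawY) => [||y]; [by apply: subexpX|by apply: subexpZ|].
  rewrite -[leLHS]real_normK ?num_real// /h -exprMn.
  rewrite lerXn2r ?nnegrE ?mulr_ge0 ?exprn_ge0 ?expR_ge0 ?invr_ge0 ?(ltW dd)//.
  rewrite /coefpsi normrM mulrA ler_wpM2r// normrM ger0_norm; last first.
    by rewrite divr_ge0 ?exprn_ge0 ?(ltW D0).
  apply: (@le_trans _ _ (D ^+ k / k`!%:R * enorm y ^+ k)).
    rewrite ler_wpM2l ?divr_ge0 ?exprn_ge0 ?(ltW D0)//.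
    exact: taylor_coef_le.
  rewrite mulrAC -exprMn -[2 * _ * D * _]mulrA; apply: pow_fact_le => //.
  by rewrite mulr_ge0 ?enorm_ge0 ?ltW.
rewrite (E0Z d_gt0 isoG lawY)// exprMn ler_wpM2l ?sqr_ge0//.
have E0h : 0 <= E0 h by apply: E0_ge0 => y; exact: sqr_ge0.
rewrite -[leLHS]sqr_sqrtr// lerXn2r ?nnegrE ?sqrtr_ge0 ?(ltW W0)//.
by rewrite lerDl.
Qed.

Let Ex_devsum n k : (0 < n)%N ->
  integrableR P (devsum n k) /\
  Ex P (devsum n k) <= 2^-1 ^+ k * W / Num.sqrt n%:R.
Proof.
move=> n0.
have idev (f : {ffun 'I_k -> 'I_d}) : integrableR P (fun w => `|dev n (coefpsi f) w|).
  by apply: integrableR_norm; exact: (integrable_dev d_gt0 isoG lawY).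
split; first exact: integrableR_sum.
rewrite /devsum Ex_sum//.
apply: (@le_trans _ _ (\sum_(f : {ffun 'I_k -> 'I_d}) (2 * d%:R)^-1 ^+ k * W / Num.sqrt n%:R)).
  by apply: ler_sum => f _; exact: Ex_coef.
rewrite sumr_const card_ffun !card_ord -[leLHS]mulr_natl natrX !mulrA -exprMn.
by rewrite invfM mulrCA divff ?mulr1// pnatr_eq0 -lt0n.
Qed.

Let Ex_env K : E0 (envpsi K) <= 2^-1 ^+ K * V.
Proof.
have se : subexp (fun y => expR (3 * D * enorm y) * `|psi y|).
  apply: subexpM; last exact: subexp_norm.
  by apply: subexp_expR_enorm; rewrite mulr_ge0 ?(ltW D0).
rewrite -(E0Z d_gt0 isoG lawY)//.
apply: (E0_le d_gt0 isoG lawY) => [||y]; [by []|by apply: subexpZ|].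
 rewrite /envpsi mulrA ler_wpM2r//.
have Dy : 0 <= D * enorm y by rewrite mulr_ge0 ?enorm_ge0 ?ltW.
apply: (@le_trans _ _ (2^-1 ^+ K * expR (2 * (D * enorm y)) * expR (D * enorm y))).
  by rewrite ler_wpM2r ?expR_ge0//; apply: pow_fact_le.
by rewrite -mulrA -expRD ler_wpM2l ?exprn_ge0// ler_expR; lra.
Qed.

Let half_le n : (0 < n)%N -> 2^-1 ^+ n <= (Num.sqrt n%:R)^-1 :> R.
Proof.
move=> n0; rewrite exprVn lef_pV2 ?posrE ?exprn_gt0 ?sqrtr_gt0 ?ltr0n//.
apply: (@le_trans _ _ n%:R).
  rewrite -[leRHS]sqr_sqrtr// expr2 ler_peMr ?sqrtr_ge0//.
  by rewrite -[leLHS]sqrtr1 ler_wsqrtr// ler1n.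
by rewrite -natrX ler_nat ltnW// ltn_expl.
Qed.

Let geometric n : \sum_(k < n) 2^-1 ^+ k <= 2 :> R.
Proof.
suff -> : \sum_(k < n) 2^-1 ^+ k = 2 - 2 * 2^-1 ^+ n :> R.
  by rewrite gerBl mulr_ge0 ?exprn_ge0.
elim: n => [|n ih]; first by rewrite big_ord0 expr0; ring.
by rewrite big_ord_recr /= ih exprS; field.
Qed.

(* Expanding to order n + 1 makes the remainder negligible while keeping
   finitely many empirical averages; [D] is arbitrary, so that no separate
   consistency argument is needed. *)
Lemma fluctuation_bound : exists C : R, forall n, (0 < n)%N ->
  exists X : T -> R, [/\ integrableR P X, forall w, 0 <= X w,
    Ex P X <= C / Num.sqrt n%:R &
    forall w dl, enorm dl <= D ->
      `|dev n (fun y => tiltsum dl y * psi y) w - dev n psi w| <=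
      X w * (enorm (Hbar *m dl) + enorm dl ^+ 2)].
Proof.
(* [2 * W] is the geometric sum of the orders. The remainder counts twice, in its empirical and its
   true mean, each at most 2^-(n+1) V and hence below V / sqrt n. *)
exists (2 * W + 2 * V) => n n0.
exists (fun w => \sum_(k < n.-1.+2) devsum n k w +
  (emp n (envpsi n.-1.+2) w + E0 (envpsi n.-1.+2))).
have idev : integrableR P (fun w => \sum_(k < n.-1.+2) devsum n k w).
  by apply: integrableR_sum => k; case: (Ex_devsum k n0).
have iemp : integrableR P (emp n (envpsi n.-1.+2)).
  exact: (integrable_emp d_gt0 isoG lawY).
have icst := integrableR_cst P (E0 (envpsi n.-1.+2)).
have W0 : 0 <= W by rewrite addr_ge0 ?sqrtr_ge0.
have V0 : 0 <= V by apply: E0_ge0 => y; rewrite mulr_ge0 ?expR_ge0.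
have s0 : 0 <= (Num.sqrt n%:R)^-1 :> R by rewrite invr_ge0 sqrtr_ge0.
split.
- by apply: integrableRD => //; exact: integrableRD.
- move=> w; apply: addr_ge0; first by apply: sumr_ge0 => k _; exact: devsum_ge0.
  by rewrite addr_ge0 ?emp_ge0 ?E0_ge0.
- rewrite (ExD idev (integrableRD iemp icst)) (ExD iemp icst) Ex_cst.
  rewrite (Ex_emp d_gt0 isoG lawY)// mulrDl; apply: lerD.
    rewrite Ex_sum; last by move=> k; case: (Ex_devsum k n0).
    apply: (@le_trans _ _ (\sum_(k < n.-1.+2) 2^-1 ^+ k * (W / Num.sqrt n%:R))).
      by apply: ler_sum => k _; rewrite mulrA; case: (Ex_devsum k n0).
    by rewrite -mulr_suml -mulrA ler_wpM2r ?geometric// mulr_ge0.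
  have h := Ex_env n.-1.+2.
  have e : 2^-1 ^+ n.-1.+2 <= (Num.sqrt n%:R)^-1 :> R.
    rewrite prednK//; apply: le_trans (half_le n0).
    by rewrite exprS ler_piMl ?exprn_ge0// invf_le1 ?ler1n.
  have : E0 (envpsi n.-1.+2) <= (Num.sqrt n%:R)^-1 * V.
    by apply: le_trans h _; rewrite ler_wpM2r.
  by nra.
- by move=> w dl dlD; exact: dev_tiltsum.
Qed.

End bounds.
End fluctuation.

(** * Test functions separating the orbit *)

Section exponential_polynomials.
Context (R : realType) (d : nat).
Implicit Types (f g : 'cV[R]_d -> R) (x y z t : 'cV[R]_d).

Definition evalp (s : seq (R * 'cV[R]_d)) x : R :=
  \sum_(p <- s) p.1 * expR (dot p.2 x).

(* The test function whose mean under the normal law N(x, I) is [evalp s x]. *)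
Definition liftp (s : seq (R * 'cV[R]_d)) y : R :=
  \sum_(p <- s) p.1 * expR (dot p.2 y - dot p.2 p.2 / 2).

Definition exppoly f := exists s, f = evalp s.

Lemma exppoly_cst c : exppoly (fun=> c).
Proof.
exists [:: (c, 0)]; apply/funext => x.
by rewrite /evalp big_seq1 dot0l expR0 mulr1.
Qed.

Lemma exppoly_exp c t : exppoly (fun x => expR (dot t x - c)).
Proof.
exists [:: (expR (- c), t)]; apply/funext => x.
by rewrite /evalp big_seq1 -expRD addrC.
Qed.

Lemma exppolyD f g : exppoly f -> exppoly g -> exppoly (fun x => f x + g x).
Proof.
move=> [s ->] [s' ->]; exists (s ++ s'); apply/funext => x.
by rewrite /evalp big_cat.
Qed.

Lemma exppolyM f g : exppoly f -> exppoly g -> exppoly (fun x => f x * g x).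
Proof.
move=> [s ->] [s' ->].
exists [seq (p.1 * q.1, p.2 + q.2) | p <- s, q <- s']; apply/funext => x.
rewrite /evalp big_allpairs_dep /= mulr_suml; apply: eq_bigr => p _.
rewrite mulr_sumr; apply: eq_bigr => q _.
by rewrite dotDl expRD mulrACA.
Qed.

Lemma exppoly_sum (I : Type) (s : seq I) (F : I -> 'cV[R]_d -> R) :
  (forall i, exppoly (F i)) -> exppoly (fun x => \sum_(i <- s) F i x).
Proof.
move=> sF; elim: s => [|i s ih].
  by under eq_fun do rewrite big_nil; exact: exppoly_cst.
by under eq_fun do rewrite big_cons; exact: exppolyD.
Qed.

Lemma exppoly_prod (I : Type) (s : seq I) (F : I -> 'cV[R]_d -> R) :
  (forall i, exppoly (F i)) -> exppoly (fun x => \prod_(i <- s) F i x).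
Proof.
move=> sF; elim: s => [|i s ih].
  by under eq_fun do rewrite big_nil; exact: exppoly_cst.
by under eq_fun do rewrite big_cons; exact: exppolyM.
Qed.

Lemma exppoly_lipschitz f z D : exppoly f -> exists2 C, 0 <= C &
  forall x, enorm x <= D -> `|f (z + x) - f z| <= C * enorm x.
Proof.
move=> [s ->]; exists (\sum_(p <- s)
    `|p.1| * expR (dot p.2 z) * (enorm p.2 * expR (enorm p.2 * D))).
  by apply: sumr_ge0 => p _; rewrite !mulr_ge0 ?enorm_ge0 ?expR_ge0.
move=> x xD; rewrite /evalp -sumrB mulr_suml; apply: le_trans (ler_norm_sum _ _ _) _.
apply: ler_sum => p _; rewrite dotDr expRD.
rewrite (_ : _ - _ = p.1 * expR (dot p.2 z) * (expR (dot p.2 x) - 1)); last by ring.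
rewrite !normrM (ger0_norm (expR_ge0 (dot p.2 z))) -[leRHS]mulrA.
rewrite ler_wpM2l ?mulr_ge0 ?expR_ge0//; apply: le_trans (expR_sub1_le _) _.
have h := dot_le p.2 x; rewrite mulrAC ler_pM ?expR_ge0// ler_expR.
by apply: le_trans h _; rewrite ler_wpM2l ?enorm_ge0.
Qed.

Lemma exppoly_bounded f z D : exppoly f -> exists2 C, 0 <= C &
  forall x, enorm x <= D -> `|f (z + x)| <= C.
Proof.
move=> /(exppoly_lipschitz z D)[C C0 hC]; exists (`|f z| + C * `|D|).
  by rewrite addr_ge0 ?mulr_ge0.
move=> x xD; rewrite -[f (z + x)](subrK (f z)) addrC.
apply: le_trans (ler_normD _ _) _; rewrite lerD2l.
apply: le_trans (hC x xD) _; rewrite ler_wpM2l//.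
exact: le_trans xD (ler_norm _).
Qed.

Lemma subexp_liftp s : subexp (liftp s).
Proof.
apply: subexp_sum => p; apply: subexpM; first exact: subexp_cst.
under eq_fun do rewrite expRD.
by apply: subexpM; [exact: subexp_expR_dot|exact: subexp_cst].
Qed.

(** A substitute for the squared distance that is an exponential polynomial; on balls the two are
    comparable, by [expdist_le] and [expdist_ge]. *)
Definition expdist x z : R := \sum_(i < d) (expR (x i 0 - z i 0) - 1) ^+ 2.

Lemma exppoly_coord i z : exppoly (fun x => expR (x i 0 - z i 0) - 1).
Proof.
apply: exppolyD; last exact: exppoly_cst.
under eq_fun do rewrite -dot_delta dotC.
exact: exppoly_exp.
Qed.

Lemma exppoly_expdist z : exppoly (expdist^~ z).
Proof.
apply: exppoly_sum => i; under eq_fun do rewrite expr2.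
by apply: exppolyM; exact: exppoly_coord.
Qed.

Lemma expdist_ge0 x z : 0 <= expdist x z.
Proof. by apply: sumr_ge0 => i _; exact: sqr_ge0. Qed.

Lemma expdistxx x : expdist x x = 0.
Proof. by rewrite /expdist big1// => i _; rewrite subrr expR0 subrr expr0n. Qed.

Lemma expdist_le x z B : enorm (x - z) <= B ->
  expdist x z <= expR B ^+ 2 * enorm (x - z) ^+ 2.
Proof.
move=> xzB; rewrite sqr_enorm mulr_sumr; apply: ler_sum => i _.
have := le_enorm (x - z) i; rewrite !mxE => h.
rewrite -expr2 -exprMn -[leLHS]real_normK ?num_real//.
rewrite -[leRHS]real_normK ?num_real// lerXn2r ?nnegrE//.
apply: le_trans (expR_sub1_le _) _.
rewrite normrM mulrC ler_wpM2r// ger0_norm ?expR_ge0// ler_expR.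
exact: le_trans h xzB.
Qed.

Lemma expdist_ge x z B : enorm (x - z) <= B ->
  expR (- B) ^+ 2 * enorm (x - z) ^+ 2 <= expdist x z.
Proof.
move=> xzB; rewrite sqr_enorm mulr_sumr; apply: ler_sum => i _.
have := le_enorm (x - z) i; rewrite !mxE => h.
rewrite -expr2 -exprMn -[leLHS]real_normK ?num_real//.
rewrite -[leRHS]real_normK ?num_real// lerXn2r ?nnegrE//.
apply: le_trans (expR_sub1_ge _).
rewrite normrM mulrC ler_wpM2l// ger0_norm ?expR_ge0// ler_expR lerN2.
exact: le_trans h xzB.
Qed.

End exponential_polynomials.

Section separation.
Context (R : realType) (d : nat).
Context (G : {fset 'M[R]_d}) (isoG : isometry_group G) (theta : 'cV[R]_d).
Implicit Types (g h : 'M[R]_d) (x z dl : 'cV[R]_d) (p : 'cV[R]_d -> R).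

Local Notation H := (stabilizer G theta).
Local Notation Hbar := (mx_average H).

Definition others : seq 'M[R]_d := [seq g <- G | g *m theta != theta].

(** A cut-off: it vanishes to second order or more at every orbit point other than theta and is
    positive at theta. *)
Definition away x : R := \prod_(g <- others) expdist x (g *m theta).

Definition coord_test i x : R := (expR (x i 0 - theta i 0) - 1) * away x.

Definition dist_test x : R := expdist x theta * away x.

Lemma exppoly_away : exppoly away.
Proof. by apply: exppoly_prod => g; exact: exppoly_expdist. Qed.

Lemma exppoly_coord_test i : exppoly (coord_test i).
Proof. exact: exppolyM (exppoly_coord _ _) exppoly_away. Qed.

Lemma exppoly_dist_test : exppoly dist_test.
Proof. exact: exppolyM (exppoly_expdist _) exppoly_away. Qed.

Lemma away_ge0 x : 0 <= away x.
Proof. by apply: prodr_ge0 => g _; exact: expdist_ge0. Qed.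

Lemma away_orbit g : g \in G -> g *m theta != theta -> away (g *m theta) = 0.
Proof.
move=> gG gth; rewrite /away (bigD1_seq g)/= ?filter_uniq ?fset_uniq//.
  by rewrite expdistxx mul0r.
by rewrite mem_filter gth.
Qed.

Lemma dist_test_orbit g : g \in G -> dist_test (g *m theta) = 0.
Proof.
move=> gG; rewrite /dist_test; have [->|gth] := eqVneq (g *m theta) theta.
  by rewrite expdistxx mul0r.
by rewrite away_orbit// mulr0.
Qed.

Lemma coord_test_orbit i g : g \in G -> coord_test i (g *m theta) = 0.
Proof.
move=> gG; rewrite /coord_test; have [->|gth] := eqVneq (g *m theta) theta.
  by rewrite subrr expR0 subrr mul0r.
by rewrite away_orbit// mulr0.
Qed.

(** For an exponential polynomial p, the expectation of its lift under the model of parameter theta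
    + dl. *)
Definition orbit_mean p dl : R :=
  #|` G|%:R^-1 * \sum_(g <- G) p (g *m (theta + dl)).

Definition nearest dl := forall g, g \in G -> enorm dl <= enorm (g *m (theta + dl) - theta).

Lemma nearest_ge dl g : nearest dl -> g \in G ->
  enorm dl <= enorm (theta + dl - g *m theta).
Proof.
move=> ndl gG.
have -> : theta + dl - g *m theta = g *m (invmx g *m (theta + dl) - theta).
  by rewrite mulmxBr (isoVK isoG).
by rewrite (iso_enorm isoG)// ndl// (isoV isoG).
Qed.

(** If theta + dl is no closer to g theta than |dl|, the triangle inequality puts it at distance at
    least |g theta - theta| / 2 from g theta. The bound [B] on that distance serves to apply
    [expdist_ge]. *)
Lemma away_lower D : exists2 c, 0 < c & forall dl, enorm dl <= D -> nearest dl ->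
  c <= away (theta + dl).
Proof.
pose B := D + (enorm theta + enorm theta).
exists (\prod_(g <- others) (expR (- B) ^+ 2 * (enorm (g *m theta - theta) / 2) ^+ 2)).
  rewrite big_seq; apply: prodr_gt0 => g; rewrite mem_filter => /andP[gth gG].
  rewrite mulr_gt0 ?exprn_gt0 ?expR_gt0// divr_gt0//.
  rewrite lt_def enorm_ge0 andbT; apply: contra_neq gth => /enorm_eq0/eqP.
  by rewrite subr_eq0 => /eqP.
move=> dl dlD ndl; rewrite /away !big_seq; apply: ler_prod => g.
rewrite mem_filter => /andP[gth gG].
rewrite mulr_ge0 ?sqr_ge0//=.
have near := nearest_ge ndl gG.
have := enormB (theta + dl) (g *m theta).
rewrite (iso_enorm isoG)// => /le_trans; move=> /(_ _ (lerD (enormD _ _) (lexx _))) le_B.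
apply: le_trans (expdist_ge (B := B) _); last by rewrite /B; move: le_B dlD; lra.
rewrite ler_wpM2l ?sqr_ge0// lerXn2r ?nnegrE ?divr_ge0 ?enorm_ge0//.
have : enorm (g *m theta - theta) <=
    enorm dl + enorm (theta + dl - g *m theta).
  rewrite (_ : g *m theta - theta = dl - (theta + dl - g *m theta)) ?enormB//.
  by rewrite opprB addrCA opprD [dl + _]addrCA subrr addr0.
by rewrite ler_pdivrMr//; move: near; lra.
Qed.

(** All terms of the orbit mean are nonnegative, so the term of the identity suffices. *)
Lemma dist_test_mean_ge D : exists2 c, 0 < c & forall dl, enorm dl <= D ->
  nearest dl -> c * enorm dl ^+ 2 <= orbit_mean dist_test dl.
Proof.
have [c c0 hc] := away_lower D.
exists (#|` G|%:R^-1 * (expR (- D) ^+ 2 * c)).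
  by rewrite mulr_gt0 ?invr_gt0 ?(cardG_gt0 isoG)// mulr_gt0 ?exprn_gt0 ?expR_gt0.
move=> dl dlD ndl; rewrite -mulrA ler_wpM2l ?invr_ge0//.
rewrite (big_fsetD1 1%:M)/=; last exact: iso1.
rewrite mul1mx ler_wpDr ?sumr_ge0// => [g _|].
  by rewrite mulr_ge0 ?expdist_ge0 ?away_ge0.
have := @expdist_ge _ _ (theta + dl) theta D.
rewrite /dist_test addrAC subrr add0r => /(_ dlD) h.
apply: (@le_trans _ _ ((expR (- D) ^+ 2 * enorm dl ^+ 2) * c)).
  by rewrite le_eqVlt; apply/orP; left; apply/eqP; ring.
apply: ler_pM => //; [|exact: ltW|exact: hc].
exact: mulr_ge0 (sqr_ge0 _) (sqr_ge0 _).
Qed.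

(** If g fixes theta, the first factor is linear in g dl and the error comes from exp t - 1 - t and
    from the variation of [away]. Otherwise [away] contains a factor that is already quadratic at g
    theta. *)
Lemma coord_test_expand i g D : g \in G -> exists2 C, 0 <= C &
  forall dl, enorm dl <= D ->
  `|coord_test i (g *m (theta + dl)) -
    (g *m theta == theta)%:R * ((g *m dl) i 0 * away theta)| <= C * enorm dl ^+ 2.
Proof.
move=> gG; have [gth|gth] := eqVneq (g *m theta) theta.
  have [C1 C10 h1] := exppoly_bounded theta D exppoly_away.
  have [C2 C20 h2] := exppoly_lipschitz theta D exppoly_away.
  exists (expR D * C1 + C2); first by rewrite addr_ge0 ?mulr_ge0 ?expR_ge0.
  move=> dl dlD; have gdlD : enorm (g *m dl) <= D by rewrite (iso_enorm isoG).
  rewrite mul1r mulmxDr gth /coord_test mxE [theta i 0 + _]addrC addrK.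
  set t := (g *m dl) i 0.
  have tdl : `|t| <= enorm dl by rewrite -(iso_enorm isoG dl gG) le_enorm.
  rewrite (_ : _ - _ = (expR t - 1 - t) * away (theta + g *m dl) +
    t * (away (theta + g *m dl) - away theta)); last by ring.
  apply: le_trans (ler_normD _ _) _; rewrite [leRHS]mulrDl !normrM; apply: lerD; last first.
    have := h2 _ gdlD; rewrite (iso_enorm isoG)// => h.
    by rewrite [leRHS]mulrC expr2 -mulrA ler_pM// mulrC.
  rewrite mulrAC ler_pM ?h1//.
  have := expR_tail t 2; rewrite !big_ord_recl big_ord0 /= expr0 fact0 divr1 addr0.
  rewrite expr1 (_ : 1`! = 1)%N// divr1 opprD addrA => /le_trans; apply.
  have e2 : expR `|t| <= expR D by rewrite ler_expR (le_trans tdl).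
  rewrite [leRHS]mulrC ler_pM ?expR_ge0 ?divr_ge0 ?sqr_ge0//.
  apply: (@le_trans _ _ (`|t| ^+ 2)).
    by rewrite ler_piMr ?sqr_ge0// invf_le1 ?ler1n.
  by rewrite lerXn2r ?nnegrE ?enorm_ge0.
(* [q] is the test without the quadratic factor attached to g; boundedness of [q] is then enough. *)
pose q x := (expR (x i 0 - theta i 0) - 1) *
  \prod_(h <- [seq h <- others | h != g]) expdist x (h *m theta).
have pq : exppoly q.
  apply: exppolyM; first exact: exppoly_coord.
  by apply: exppoly_prod => h; exact: exppoly_expdist.
have [C C0 hC] := exppoly_bounded (g *m theta) D pq.
exists (C * expR D ^+ 2); first by rewrite mulr_ge0 ?sqr_ge0.
move=> dl dlD; have gdlD : enorm (g *m dl) <= D by rewrite (iso_enorm isoG).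
rewrite mul0r subr0 mulmxDr.
have -> : coord_test i (g *m theta + g *m dl) =
    q (g *m theta + g *m dl) * expdist (g *m theta + g *m dl) (g *m theta).
  rewrite /coord_test /q /away (bigD1_seq g)/= ?filter_uniq ?fset_uniq//.
    by rewrite big_filter; ring.
  by rewrite mem_filter gth.
rewrite normrM -mulrA ler_pM ?hC// ger0_norm ?expdist_ge0//.
have := @expdist_le _ _ (g *m theta + g *m dl) (g *m theta) D.
by rewrite addrAC subrr add0r (iso_enorm isoG)//; apply.
Qed.

(** The linear terms come from the stabilizer alone, and the sum of g dl over it is its cardinality
    times Hbar dl. *)
Lemma coord_test_mean i D : exists2 C, 0 <= C & forall dl, enorm dl <= D ->
  `|orbit_mean (coord_test i) dl -
    #|` H|%:R / #|` G|%:R * away theta * (Hbar *m dl) i 0| <= C * enorm dl ^+ 2.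
Proof.
have cG := cardG_gt0 isoG.
have /choice[C hC] g : exists C, g \in G -> 0 <= C /\ forall dl, enorm dl <= D ->
  `|coord_test i (g *m (theta + dl)) -
    (g *m theta == theta)%:R * ((g *m dl) i 0 * away theta)| <= C * enorm dl ^+ 2.
  have [gG|gG] := boolP (g \in G); last by exists 0.
  by have [C C0 hC] := coord_test_expand i D gG; exists C.
exists (#|` G|%:R^-1 * \sum_(g <- G) C g).
  rewrite mulr_ge0 ?invr_ge0// big_seq; apply: sumr_ge0 => g gG.
  by case: (hC g gG).
move=> dl dlD.
have -> : #|` H|%:R / #|` G|%:R * away theta * (Hbar *m dl) i 0 =
    #|` G|%:R^-1 * \sum_(g <- G) (g *m theta == theta)%:R * ((g *m dl) i 0 * away theta).
  rewrite averageE mxE summxE.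
  have -> : \sum_(g <- G) (g *m theta == theta)%:R * ((g *m dl) i 0 * away theta) =
      (\sum_(h <- H) (h *m dl) i 0) * away theta.
    rewrite mulr_suml.
    transitivity (\sum_(g <- G | g *m theta == theta) (g *m dl) i 0 * away theta).
      rewrite [RHS]big_mkcond /=; apply: eq_bigr => g _.
      by case: eqP; rewrite ?mul1r ?mul0r.
    by rewrite big_fset_condE; apply: eq_fbigl => g; rewrite !inE.
  by field; rewrite !gt_eqF ?(cardH_gt0 isoG).
rewrite /orbit_mean -mulrBr -sumrB normrM (ger0_norm (_ : 0 <= #|` G|%:R^-1))//.
rewrite -mulrA ler_wpM2l ?invr_ge0//; apply: le_trans (ler_norm_sum _ _ _) _.
by rewrite mulr_suml !big_seq; apply: ler_sum => g gG; case: (hC g gG) => _; apply.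
Qed.

Lemma away_theta_gt0 : 0 < away theta.
Proof.
have [c c0] := away_lower 0; move=> /(_ 0); rewrite addr0.
have e0 : enorm (0 : 'cV[R]_d) = 0 by rewrite enorm_dot dot0l sqrtr0.
by rewrite e0 => /(_ (lexx _)) h; apply: lt_le_trans c0 (h _) => g gG; rewrite e0 enorm_ge0.
Qed.

Definition test (j : option 'I_d) : 'cV[R]_d -> R :=
  if j is Some i then coord_test i else dist_test.

(* The coordinate tests are linear in the displacement along the fixed space of
   the stabilizer, and the distance test is quadratic: this is where the two
   rates come from. *)
Lemma separation D : exists2 C, 0 <= C & forall dl, enorm dl <= D -> nearest dl ->
  enorm (Hbar *m dl) + enorm dl ^+ 2 <= C * \sum_j `|orbit_mean (test j) dl|.
Proof.
have [c c0 hc] := dist_test_mean_ge D.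
have /choice[C hC] i : exists C, 0 <= C /\ forall dl, enorm dl <= D ->
  `|orbit_mean (coord_test i) dl -
    #|` H|%:R / #|` G|%:R * away theta * (Hbar *m dl) i 0| <= C * enorm dl ^+ 2.
  by have [C C0 hC] := coord_test_mean i D; exists C.
pose a := #|` H|%:R / #|` G|%:R * away theta.
have a0 : 0 < a.
  by rewrite mulr_gt0 ?away_theta_gt0 ?divr_gt0 ?(cardH_gt0 isoG) ?(cardG_gt0 isoG).
pose S := \sum_i C i; have S0 : 0 <= S by apply: sumr_ge0 => i _; case: (hC i).
(* The distance test bounds |dl|^2 on its own, by B / c; this absorbs the error S |dl|^2 that the
   coordinate tests leave in the bound a^-1 (A + S |dl|^2) on |Hbar dl|. *)
exists (a^-1 + (a^-1 * S + 1) / c).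
  by rewrite addr_ge0 ?divr_ge0 ?addr_ge0 ?mulr_ge0 ?invr_ge0 ?(ltW a0) ?(ltW c0).
move=> dl dlD ndl.
pose A := \sum_i `|orbit_mean (coord_test i) dl|.
pose B := `|orbit_mean dist_test dl|.
have A0 : 0 <= A by apply: sumr_ge0 => i _; exact: normr_ge0.
have B0 : 0 <= B by exact: normr_ge0.
have -> : \sum_j `|orbit_mean (test j) dl| = B + A.
  rewrite (bigD1 None)//=; congr (_ + _).
  rewrite (reindex_omap Some id)/= => [|[i|]//].
  by apply: eq_big => // i; rewrite eqxx.
have dB : enorm dl ^+ 2 <= c^-1 * B.
  by rewrite ler_pdivlMl// (le_trans (hc _ dlD ndl))// ler_norm.
have uA : enorm (Hbar *m dl) <= a^-1 * (A + S * enorm dl ^+ 2).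
  rewrite ler_pdivlMl//; apply: (@le_trans _ _ (a * \sum_i `|(Hbar *m dl) i 0|)).
    by rewrite ler_wpM2l ?(ltW a0) ?enorm_le_sum.
  rewrite mulr_sumr mulr_suml -big_split; apply: ler_sum => i _ /=.
  have [_ /(_ _ dlD)] := hC i; rewrite -/a => h.
  rewrite -[a in a * _](gtr0_norm a0) -normrM.
  rewrite (_ : a * _ = orbit_mean (coord_test i) dl -
    (orbit_mean (coord_test i) dl - a * (Hbar *m dl) i 0)); last by ring.
  by apply: le_trans (ler_normB _ _) _; rewrite lerD2l.
have ia0 : 0 <= a^-1 by rewrite invr_ge0 ltW.
apply: (@le_trans _ _ (a^-1 * A + (a^-1 * S + 1) * (c^-1 * B))).
  have : (a^-1 * S + 1) * enorm dl ^+ 2 <= (a^-1 * S + 1) * (c^-1 * B).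
    by rewrite ler_wpM2l ?addr_ge0 ?mulr_ge0.
  by move: uA; lra.
have e1 : 0 <= a^-1 * B by rewrite mulr_ge0.
have e2 : 0 <= (a^-1 * S + 1) / c * A.
  by rewrite mulr_ge0 ?divr_ge0 ?addr_ge0 ?mulr_ge0 ?(ltW c0).
move: e1 e2; lra.
Qed.

End separation.

(** * Rate of convergence *)

Section rate.
Context (R : realType) (d : nat) (d_gt0 : (0 < d)%N).
Context (G : {fset 'M[R]_d}) (isoG : isometry_group G) (theta : 'cV[R]_d).
Context (disp : measure_display) (T : measurableType disp).
Context (P : probability T R) (Y : nat -> {RV P >-> 'cV[R]_d}).
Hypothesis lawY : forall i (A : set 'cV[R]_d), measurable A ->
  distribution P (Y i) A = mixture_law G theta A.
Hypothesis indepY : mutually_independent Y.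

Local Notation E0 := (expect0 Y).
Local Notation emp := (emp_mean Y).
Local Notation dev := (emp_dev Y).
Local Notation Hbar := (mx_average (stabilizer G theta)).
Local Notation tiltsum := (tilt_sum G theta).
Local Notation tiltcst := (tilt_cst theta).
Local Notation lratio := (lik_ratio G theta).

Lemma subexp_lratio dl : subexp (lratio (theta + dl)).
Proof.
rewrite (_ : lratio _ = (fun y => tiltcst dl * tiltsum dl y)).
  by apply: subexpZ; exact: subexp_tiltsum.
by apply/funext => y; rewrite lratioE.
Qed.

Lemma E0_lratio_liftp s dl :
  E0 (fun y => lratio (theta + dl) y * liftp s y) =
  #|` G|%:R^-1 * \sum_(g <- G) evalp s (g *m (theta + dl)).
Proof.
have sl := subexp_lratio dl.
pose f (p : R * 'cV[R]_d) y :=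
  expR (dot p.2 y - dot p.2 p.2 / 2) * lratio (theta + dl) y.
have sf p : subexp (f p).
  apply: subexpM => //; under eq_fun do rewrite expRD.
  by apply: subexpM; [exact: subexp_expR_dot|exact: subexp_cst].
have E0f p : E0 (f p) =
    #|` G|%:R^-1 * \sum_(g <- G) expR (dot p.2 (g *m (theta + dl))).
  have := integral_tilt_lratio isoG lawY p.2 0 (subexp_measurable sl).
  by rewrite -integrableR_fin => [[]|]//; exact: (integrable_subexp d_gt0 isoG lawY 0 (sf p)).
rewrite (_ : (fun y => _) = (fun y => \sum_(p <- s) p.1 * f p y)); last first.
  apply/funext => y; rewrite /liftp mulr_sumr; apply: eq_bigr => p _.
  by rewrite /f; ring.
rewrite (E0_sum d_gt0 isoG lawY); last by move=> p; exact: subexpZ.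
rewrite /evalp exchange_big /= mulr_sumr; apply: eq_bigr => p _.
by rewrite (E0Z d_gt0 isoG lawY)// E0f -mulr_sumr mulrCA.
Qed.

Lemma lratio_theta y : lratio (theta + 0) y = 1.
Proof. by rewrite addr0 /lik_ratio divff// gt_eqF// likelihood_gt0. Qed.

Lemma E0_lratio dl : E0 (lratio (theta + dl)) = 1.
Proof.
have l1 (y : 'cV[R]_d) : liftp [:: (1, 0)] y = 1.
  by rewrite /liftp big_seq1 !dot0l mul0r subr0 expR0 mulr1.
have e1 (x : 'cV[R]_d) : evalp [:: (1, 0)] x = 1.
  by rewrite /evalp big_seq1 dot0l expR0 mulr1.
have := E0_lratio_liftp [:: (1, 0)] dl.
under eq_fun do rewrite l1 mulr1.
move=> ->; under eq_bigr do rewrite e1.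
rewrite big_const_seq count_predT iter_addr_0 mulVf//.
by rewrite gt_eqF// (cardG_gt0 isoG).
Qed.

(** Vanishing on the orbit of theta makes the lift centred under the true law, so subtracting 1 from
    the ratio leaves the mean unchanged. *)
Lemma E0_test s dl : (forall g, g \in G -> evalp s (g *m theta) = 0) ->
  E0 (fun y => (lratio (theta + dl) y - 1) * liftp s y) =
  orbit_mean G theta (evalp s) dl.
Proof.
move=> s0; have sl := subexp_lratio dl; have ss := subexp_liftp s.
rewrite (_ : (fun y => _) = (fun y => lratio (theta + dl) y * liftp s y - liftp s y)).
  rewrite (E0B d_gt0 isoG lawY)//; last exact: subexpM.
  rewrite E0_lratio_liftp [X in _ - X](_ : _ = 0) ?subr0//.
  transitivity (E0 (fun y => lratio (theta + 0) y * liftp s y)).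
    by congr (expect0 Y _); apply/funext => y; rewrite lratio_theta mul1r.
  by rewrite E0_lratio_liftp addr0 big_seq big1 ?mulr0.
by apply/funext => y; rewrite mulrBl mul1r.
Qed.

(** Dominates ((sqrt rho + 1) psi)^2 uniformly over |dl| <= D, through (sqrt rho + 1)^2 <= 2 (1 +
    rho); it is the second factor of the Cauchy-Schwarz step. *)
Definition envelope D psi (y : 'cV[R]_d) : R :=
  2 * (1 + expR (enorm theta * D) * expR (D * enorm y)) * psi y ^+ 2.

Lemma subexp_envelope D psi : 0 <= D -> subexp psi -> subexp (envelope D psi).
Proof.
move=> D0 spsi; apply: subexpM; last exact: subexpX.
apply: subexpZ; apply: subexpD; first exact: subexp_cst.
by apply: subexpZ; exact: subexp_expR_enorm.
Qed.

Lemma envelope_ge0 D psi y : 0 <= envelope D psi y.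
Proof.
rewrite mulr_ge0 ?sqr_ge0// mulr_ge0// addr_ge0// mulr_ge0 ?expR_ge0//.
Qed.

(** Gathers the random bounds behind the rate at one common level M, so that [rate_bound] is a
    deterministic statement about a fixed sample. *)
Definition controlled D psi n w (M : R) := [/\
  forall dl, enorm dl <= D ->
    `|dev n (fun y => tiltsum dl y * psi y) w - dev n psi w| <=
    M / Num.sqrt n%:R * (enorm (Hbar *m dl) + enorm dl ^+ 2),
  `|dev n psi w| <= M / Num.sqrt n%:R &
  emp n (envelope D psi) w <= M].

Lemma controlled_le D psi n w M M' : M <= M' ->
  controlled D psi n w M -> controlled D psi n w M'.
Proof.
move=> MM [h1 h2 h3].
have q : M / Num.sqrt n%:R <= M' / Num.sqrt n%:R.
  by rewrite ler_wpM2r// invr_ge0 sqrtr_ge0.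
split; [move=> dl dlD|exact: le_trans h2 q|exact: le_trans h3 MM].
apply: le_trans (h1 _ dlD) _.
by rewrite ler_wpM2r// addr_ge0 ?enorm_ge0 ?sqr_ge0.
Qed.

(** The level is the sum of the three rescaled random quantities, so it dominates each of them; its
    mean is bounded in n, which is the input for Markov. *)
Lemma control D psi : 1 <= D -> subexp psi -> exists C : R, forall n, (0 < n)%N ->
  exists X : T -> R, [/\ integrableR P X, forall w, 0 <= X w, Ex P X <= C &
    forall w, controlled D psi n w (X w)].
Proof.
move=> D1 spsi; have D0 : 0 <= D by exact: le_trans D1.
have [C hC] := fluctuation_bound d_gt0 isoG lawY indepY spsi D1.
pose W := Num.sqrt (E0 (fun y => psi y ^+ 2)) + 1.
have W0 : 0 < W by rewrite ltr_wpDl ?sqrtr_ge0.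
exists (C + (W + E0 (envelope D psi))) => n n0.
have [X [iX X0 EX hX]] := hC _ n0.
have sn : 0 < Num.sqrt n%:R :> R by rewrite sqrtr_gt0 ltr0n.
have se := subexp_envelope D0 spsi.
have i1 := integrableRZ (Num.sqrt n%:R) iX.
have i2 := integrableRZ (Num.sqrt n%:R) (integrableR_norm (integrable_dev d_gt0 isoG lawY n spsi)).
have i3 := integrable_emp d_gt0 isoG lawY n se.
exists (fun w => Num.sqrt n%:R * X w + (Num.sqrt n%:R * `|dev n psi w| + emp n (envelope D psi) w)).
have e0 w : 0 <= emp n (envelope D psi) w.
  by apply: emp_ge0 => y; exact: envelope_ge0.
have x0 w : 0 <= Num.sqrt n%:R * X w by rewrite mulr_ge0 ?(ltW sn).
have d0 w : 0 <= Num.sqrt n%:R * `|dev n psi w| by rewrite mulr_ge0 ?(ltW sn).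
split.
- by apply: integrableRD => //; exact: integrableRD.
- by move=> w; rewrite addr_ge0// addr_ge0.
- rewrite (ExD i1 (integrableRD i2 i3)) (ExD i2 i3) ExZ// ExZ; last first.
    by apply: integrableR_norm; exact: (integrable_dev d_gt0 isoG lawY).
  rewrite (Ex_emp d_gt0 isoG lawY)//; apply: lerD; first by rewrite mulrC -ler_pdivlMr.
  rewrite lerD2r mulrC -ler_pdivlMr//.
  apply: (Ex_norm_dev d_gt0 isoG lawY) => //.
  have E20 : 0 <= E0 (fun y => psi y ^+ 2) by apply: E0_ge0 => y; exact: sqr_ge0.
  by rewrite -[leLHS]sqr_sqrtr// lerXn2r ?nnegrE ?sqrtr_ge0 ?(ltW W0)// lerDl.
- move=> w; have ex : X w <= (Num.sqrt n%:R * X w + (Num.sqrt n%:R * `|dev n psi w| +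
      emp n (envelope D psi) w)) / Num.sqrt n%:R.
    by rewrite ler_pdivlMr// mulrC lerDl addr_ge0.
  split.
  + move=> dl dlD; apply: le_trans (hX _ _ dlD) _.
    by rewrite ler_wpM2r// addr_ge0 ?enorm_ge0 ?sqr_ge0.
  + rewrite ler_pdivlMr// mulrC.
    by have := x0 w; have := e0 w; lra.
  + by have := x0 w; have := d0 w; lra.
Qed.

Lemma control_family (J : finType) D (psi : J -> 'cV[R]_d -> R) : 1 <= D ->
  (forall j, subexp (psi j)) -> exists C : R, forall n, (0 < n)%N ->
  exists X : T -> R, [/\ integrableR P X, forall w, 0 <= X w, Ex P X <= C &
    forall w j, controlled D (psi j) n w (X w)].
Proof.
move=> D1 spsi; have /choice[C hC] j := control D1 (spsi j).
exists (\sum_j C j) => n n0.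
have /choice[X hX] j := hC j _ n0.
exists (fun w => \sum_j X j w); split.
- by apply: integrableR_sum => j; case: (hX j).
- by move=> w; apply: sumr_ge0 => j _; case: (hX j).
- rewrite Ex_sum; last by move=> j; case: (hX j).
  by apply: ler_sum => j _; case: (hX j).
- move=> w j; have [_ _ _ /(_ w)] := hX j; apply: controlled_le.
  rewrite (bigD1 j)//= lerDl; apply: sumr_ge0 => i _.
  by case: (hX i).
Qed.

Lemma tiltcst_le dl D : enorm dl <= D -> tiltcst dl <= expR (enorm theta * D).
Proof.
move=> dlD; rewrite ler_expR.
have := le_trans (ler_norm _) (dot_le theta (- dl)).
rewrite dotNr enormN => h; have := dotxx_ge0 dl.
have : enorm theta * enorm dl <= enorm theta * D by rewrite ler_wpM2l ?enorm_ge0.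
by move: h; lra.
Qed.

(** Averaging over the stabilizer preserves the inner product with theta, so the linear part of the
    exponent only sees Hbar dl. *)
Lemma tiltcst_sub1 dl D : enorm dl <= D -> `|tiltcst dl - 1| <=
  (enorm theta + 1) * expR (enorm theta * D + D ^+ 2) *
  (enorm (Hbar *m dl) + enorm dl ^+ 2).
Proof.
move=> dlD; apply: le_trans (expR_sub1_le _) _; set x := _ - _.
have u0 := enorm_ge0 (Hbar *m dl); have t0 := enorm_ge0 theta.
have l0 := enorm_ge0 dl.
have xE : `|x| <= enorm theta * enorm (Hbar *m dl) + enorm dl ^+ 2 / 2.
  rewrite /x -(dot_theta_average isoG) -sqr_enorm; apply: le_trans (ler_normB _ _) _.
  rewrite normrN lerD ?dot_le// ger0_norm// divr_ge0// sqr_ge0//.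
rewrite mulrAC; apply: ler_pM => //; rewrite ?expR_ge0//.
  by apply: le_trans xE _; have := sqr_ge0 (enorm dl); nra.
rewrite ler_expR; apply: le_trans xE _; apply: lerD.
  rewrite ler_wpM2l//; exact: le_trans (enorm_average isoG _ _) dlD.
apply: (@le_trans _ _ (enorm dl ^+ 2)).
  by have := sqr_ge0 (enorm dl); lra.
by rewrite lerXn2r ?nnegrE// (le_trans l0).
Qed.

Lemma log_likelihood_emp n w th :
  log_likelihood G (sample Y n w) th = emp n (fun y => ln (likelihood G y th)) w.
Proof.
rewrite /log_likelihood /emp_mean; congr (_ * _).
by apply: eq_bigr => i _; rewrite tnth_mktuple.
Qed.

Lemma emp_ln_lratio n w th : emp n (fun y => ln (lratio th y)) w =
  log_likelihood G (sample Y n w) th - log_likelihood G (sample Y n w) theta.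
Proof.
rewrite !log_likelihood_emp -empB; congr (_ * _); apply: eq_bigr => i _.
by rewrite ln_div ?posrE ?likelihood_gt0.
Qed.

Lemma hellinger_le n w th : (0 < n)%N ->
  log_likelihood G (sample Y n w) theta <= log_likelihood G (sample Y n w) th ->
  emp n (fun y => (Num.sqrt (lratio th y) - 1) ^+ 2) w <=
  emp n (lratio th) w - 1.
Proof.
move=> n0 le_th.
have : emp n (fun y => ln (lratio th y)) w <=
    emp n (fun y => (lratio th y - 1) - (Num.sqrt (lratio th y) - 1) ^+ 2) w.
  by apply: emp_le => y; exact: ln_le_sqrt (lratio_gt0 isoG _ _ _).
have -> : emp n (fun y => (lratio th y - 1) - (Num.sqrt (lratio th y) - 1) ^+ 2) w =
    emp n (lratio th) w - 1 -
    emp n (fun y => (Num.sqrt (lratio th y) - 1) ^+ 2) w.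
  by rewrite /emp_mean !sumrB !mulrBr mean_cst.
rewrite (emp_ln_lratio n w th) => h.
by rewrite -subr_ge0 (le_trans _ h)// subr_ge0.
Qed.

Lemma sqrD1_le (q : R) : (q + 1) ^+ 2 <= 2 * (1 + q ^+ 2).
Proof. by have := sqr_ge0 (q - 1); lra. Qed.

Lemma rate_bound D M (psi : option 'I_d -> 'cV[R]_d -> R) C : 0 <= D -> 0 <= M -> 0 <= C ->
  (forall j, subexp (psi j)) ->
  (forall dl, enorm dl <= D -> nearest G theta dl ->
    enorm (Hbar *m dl) + enorm dl ^+ 2 <=
    C * \sum_j `|E0 (fun y => (lratio (theta + dl) y - 1) * psi j y)|) ->
  exists C', forall n w dl, (0 < n)%N -> enorm dl <= D -> nearest G theta dl ->
    log_likelihood G (sample Y n w) theta <=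
      log_likelihood G (sample Y n w) (theta + dl) ->
    controlled D (fun=> 1) n w M ->
    (forall j, controlled D (psi j) n w M) ->
    enorm (Hbar *m dl) + enorm dl ^+ 2 <= C' / Num.sqrt n%:R.
Proof.
move=> D0 M0 C0 spsi sep.
pose K := expR (enorm theta * D).
pose L := (enorm theta + 1) * expR (enorm theta * D + D ^+ 2).
have K0 : 0 <= K by exact: expR_ge0.
have L0 : 0 <= L by rewrite mulr_ge0 ?expR_ge0 ?addr_ge0 ?enorm_ge0.
pose N := #|{: option 'I_d}|%:R : R.
pose a := C * N * ((K + L) * M); pose b := C * N * Num.sqrt (K * M * M).
have a0 : 0 <= a by rewrite !mulr_ge0 ?addr_ge0.
have b0 : 0 <= b by rewrite !mulr_ge0 ?sqrtr_ge0.
(* With e = n^(-1/2) and s = sqrt (e r), the goal is r <= c s. In the bound a e r + b s one writes e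
   r = s s and uses s <= sqrt (D + D^2), as e <= 1 and r <= D + D^2. Squaring and dividing by r
   gives r <= c^2 e. *)
exists ((a * Num.sqrt (D + D ^+ 2) + b) ^+ 2) => n w dl n0 dlD ndl le_dl c1 cpsi.
set r := _ + enorm dl ^+ 2; set e := (Num.sqrt n%:R)^-1.
have sn : 0 < Num.sqrt n%:R :> R by rewrite sqrtr_gt0 ltr0n.
have e0 : 0 <= e by rewrite invr_ge0 ltW.
have e1 : e <= 1.
  by rewrite invf_le1// -[leLHS]sqrtr1 ler_wsqrtr// ler1n.
have r0 : 0 <= r by rewrite addr_ge0 ?enorm_ge0 ?sqr_ge0.
have rD : r <= D + D ^+ 2.
  apply: lerD; first exact: le_trans (enorm_average isoG _ _) dlD.
  by rewrite lerXn2r ?nnegrE ?enorm_ge0.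
pose rho := lratio (theta + dl).
have srho : subexp rho := subexp_lratio dl.
have rhoE y : rho y = tiltcst dl * tiltsum dl y by rewrite /rho lratioE.
have kK : tiltcst dl <= K := tiltcst_le dlD.
have k0 : 0 <= tiltcst dl by exact: expR_ge0.
have rho0 y : 0 <= rho y by exact: lratio_ge0.
have emp_rho : emp n rho w - 1 <= K * (M * e) * r.
  (* The ratio has true mean 1, so this is a deviation, controlled by the constant test, whose own
     deviation is 0. *)
  have -> : emp n rho w - 1 = tiltcst dl * dev n (fun y => tiltsum dl y * 1) w.
    rewrite -(devZ d_gt0 isoG lawY); last first.
      by apply: subexpM; [exact: subexp_tiltsum|exact: subexp_cst].
    under eq_fun do rewrite mulr1 -rhoE.
    by rewrite /emp_dev E0_lratio.
  have [/(_ _ dlD) + _ _] := c1.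
  rewrite dev_cst// subr0 -/e -/r => h.
  apply: (@le_trans _ _ (tiltcst dl * (M * e * r))).
    by rewrite ler_wpM2l// (le_trans (ler_norm _)).
  by rewrite -[leRHS]mulrA ler_wpM2r// mulr_ge0// mulr_ge0.
have hell : emp n (fun y => (Num.sqrt (rho y) - 1) ^+ 2) w <= K * (M * e) * r.
  by apply: le_trans emp_rho; exact: hellinger_le.
set s := Num.sqrt (e * r).
have s0 : 0 <= s by exact: sqrtr_ge0.
have s2 : s ^+ 2 = e * r by rewrite sqr_sqrtr// mulr_ge0.
have bound j : `|E0 (fun y => (rho y - 1) * psi j y)| <=
    (K + L) * M * (e * r) + Num.sqrt (K * M * M) * s.
  have [/(_ _ dlD) c_a c_b c_c] := cpsi j.
  rewrite -/e -/r in c_a c_b.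
  have sprod : subexp (fun y => (rho y - 1) * psi j y).
    by apply: subexpM => //; apply: subexpB => //; exact: subexp_cst.
  have stp : subexp (fun y => tiltsum dl y * psi j y).
    by apply: subexpM => //; exact: subexp_tiltsum.
  have -> : E0 (fun y => (rho y - 1) * psi j y) =
      emp n (fun y => (rho y - 1) * psi j y) w -
      dev n (fun y => (rho y - 1) * psi j y) w by rewrite /emp_dev; ring.
  apply: le_trans (ler_normB _ _) _; rewrite addrC; apply: lerD.
    rewrite (_ : (fun y => _) = (fun y => tiltcst dl * (tiltsum dl y * psi j y) +
        (-1) * psi j y)); last first.
      by apply/funext => y; rewrite rhoE; ring.
    rewrite (devD d_gt0 isoG lawY) ?(devZ d_gt0 isoG lawY)//; try exact: subexpZ.
    (* This grouping shows smallness twice: the first difference is O(e r) by control, and in the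
       second term a deviation O(e) meets a factor O(r). *)
    rewrite (_ : _ + _ = tiltcst dl * (dev n (fun y => tiltsum dl y * psi j y) w -
      dev n (psi j) w) + (tiltcst dl - 1) * dev n (psi j) w); last by ring.
    apply: le_trans (ler_normD _ _) _.
    rewrite [leRHS](_ : _ = K * (M * e * r) + L * r * (M * e)); last by ring.
    apply: lerD; rewrite normrM.
      by rewrite (ger0_norm k0); apply: ler_pM.
    by apply: ler_pM => //; exact: tiltcst_sub1.
  rewrite -(@ler_pXn2r _ 2)// ?nnegrE ?mulr_ge0 ?sqrtr_ge0//.
  rewrite real_normK ?num_real// [leRHS]exprMn s2 sqr_sqrtr ?mulr_ge0//.
  (* rho - 1 = (sqrt rho - 1)(sqrt rho + 1): the first factor is bounded by the Hellinger estimate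
     [hell], the second by the envelope. *)
  rewrite (_ : (fun y => _) = (fun y => (Num.sqrt (rho y) - 1) *
      ((Num.sqrt (rho y) + 1) * psi j y))); last first.
    apply/funext => y; rewrite mulrA; congr (_ * _).
    by rewrite -{1}(sqr_sqrtr (rho0 y)); ring.
  apply: le_trans (emp_cauchy_schwarz _ _ _ _ _) _.
  rewrite (_ : K * M * M * (e * r) = (K * (M * e) * r) * M); last by ring.
  apply: ler_pM => //.
  - by apply: emp_ge0 => y; exact: sqr_ge0.
  - by apply: emp_ge0 => y; exact: sqr_ge0.
  - apply: le_trans c_c; apply: emp_le => y.
    rewrite exprMn ler_wpM2r ?sqr_ge0//.
    have : (Num.sqrt (rho y) + 1) ^+ 2 <= 2 * (1 + rho y).
      by rewrite -{2}(sqr_sqrtr (rho0 y)) sqrD1_le.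
    move=> /le_trans; apply; rewrite ler_wpM2l// lerD2l rhoE; apply: ler_pM => //.
      exact: tiltsum_ge0.
    apply: le_trans (ler_norm _) (le_trans (tiltsum_le isoG _ _ _) _).
    by rewrite ler_expR ler_wpM2r ?enorm_ge0.
have main : r <= a * (e * r) + b * s.
  apply: le_trans (sep _ dlD ndl) _.
  apply: (@le_trans _ _ (C * \sum_(j : option 'I_d)
     ((K + L) * M * (e * r) + Num.sqrt (K * M * M) * s))).
    by rewrite ler_wpM2l// ler_sum.
  rewrite sumr_const -[X in C * X]mulr_natl /a /b -/N.
  by rewrite le_eqVlt; apply/orP; left; apply/eqP; ring.
set c := a * _ + b; have c0 : 0 <= c.
  by apply: addr_ge0 => //; apply: mulr_ge0 => //; exact: sqrtr_ge0.
have rcs : r <= c * s.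
  apply: le_trans main _; rewrite /c mulrDl lerD2r -s2 expr2 -mulrA ler_wpM2l//.
  rewrite ler_wpM2r// /s ler_wsqrtr//.
  by apply: le_trans rD; rewrite ler_piMl.
have [->|rn0] := eqVneq r 0; first by rewrite mulr_ge0 ?sqr_ge0.
have rp : 0 < r by rewrite lt_def rn0.
rewrite -(ler_pM2r rp) -expr2 -mulrA -/e -s2 -exprMn.
by rewrite lerXn2r ?nnegrE// mulr_ge0.
Qed.

End rate.

(** * Measurable selection of the nearest orbit point *)

Section alignment.
Context (R : realType) (d : nat).
Context (G : {fset 'M[R]_d}) (isoG : isometry_group G) (theta : 'cV[R]_d).
Implicit Types (x y th : 'cV[R]_d) (s : seq 'M[R]_d).

(** The fold starts from the identity, itself an element of the group, and decides by comparing
    norms, which keeps the minimizer a measurable function of x. *)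
Definition closest_in s x : 'M[R]_d := foldr (fun g m =>
  if enorm (g *m x - theta) <= enorm (m *m x - theta) then g else m) 1%:M s.

Definition closest := closest_in G.

Lemma closest_in_min s x g : g \in s ->
  enorm (closest_in s x *m x - theta) <= enorm (g *m x - theta).
Proof.
elim: s => //= h s ih; rewrite inE => /orP[/eqP->|/ih le_g]; case: ifP => //.
- by move=> /negbT; rewrite -ltNge => /ltW.
- by move=> h1; exact: le_trans le_g.
Qed.

Lemma closest_in_mem s x : closest_in s x \in 1%:M :: s.
Proof.
elim: s => [|h s ih] /=; first by rewrite inE.
case: ifP => _; first by rewrite !inE eqxx orbT.
by move: ih; rewrite !inE => /orP[->//|->]; rewrite !orbT.
Qed.

Lemma closest_mem x : closest x \in G.
Proof.
rewrite /closest; have := closest_in_mem G x; rewrite inE => /orP[/eqP ->|//].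
exact: iso1.
Qed.

Lemma measurable_closest disp (T : measurableType disp) (f : T -> 'cV[R]_d) :
  measurable_fun setT f -> measurable_fun setT (fun t => closest (f t)).
Proof.
move=> mf; rewrite /closest; elim: (G : seq _) => [|g s ih] /=.
  exact: measurable_cst.
have mdist (m : T -> 'M[R]_d) : measurable_fun setT m ->
    measurable_fun setT (fun t => enorm (m t *m f t - theta)).
  move=> mm; apply: measurable_fun_enorm; apply: measurable_fun_addmx => //.
  exact: measurable_fun_mulmx.
apply: measurable_fun_ifT => //.
apply: measurable_fun_ler; first exact: (mdist (fun=> g)).
exact: mdist.
Qed.

Lemma nearest_closest x : nearest G theta (closest x *m x - theta).
Proof.
move=> g gG; rewrite [theta + _]addrC subrK mulmxA.
apply: closest_in_min; apply: isoM => //; exact: closest_mem.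
Qed.

Lemma likelihood_iso y th g : g \in G ->
  likelihood G y (g *m th) = likelihood G y th.
Proof.
move=> gG; pose F x := \sum_(h <- G) expR (- (enorm (y - h *m x) ^+ 2 / 2)).
have e : F (g *m th) = F th.
  rewrite -[RHS](sum_iso_mulr isoG (fun h => expR (- (enorm (y - h *m th) ^+ 2 / 2))) gG).
  by apply: eq_bigr => h _; rewrite mulmxA.
exact: (congr1 (fun z => (#|` G|%:R * (2 * pi) `^ (d%:R / 2))^-1 * z) e).
Qed.

(** The comparison with the parameter 0 holds component by component, by Cauchy-Schwarz for <y, g
    th>. *)
Lemma likelihood_le y th : likelihood G y th <=
  likelihood G y 0 * expR (enorm y * enorm th - enorm th ^+ 2 / 2).
Proof.
rewrite /likelihood -mulrA ler_wpM2l ?invr_ge0 ?mulr_ge0 ?powR_ge0//.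
rewrite mulr_suml !big_seq; apply: ler_sum => g gG.
rewrite mulmx0 subr0 -expRD ler_expR [X in - (X / 2)]sqr_enorm.
rewrite !(dotDl, dotDr, dotNl, dotNr) (iso_dot isoG)// -!sqr_enorm.
have := le_trans (ler_norm _) (dot_le (g *m th) y).
by rewrite (iso_enorm isoG)// (dotC y); lra.
Qed.

End alignment.

Theorem theorem3 (R : realType) (d : nat) (d_gt0 : (0 < d)%N)
    (G : {fset 'M[R]_d}) (isoG : isometry_group G) (theta : 'cV[R]_d)
    (disp : measure_display) (T : measurableType disp) (P : probability T R)
    (Y : nat -> {RV P >-> 'cV[R]_d})
    (indepY : mutually_independent Y)
    (lawY : forall i (A : set 'cV[R]_d), measurable A ->
      distribution P (Y i) A = mixture_law G theta A)
    (that : forall n, n.-tuple 'cV[R]_d -> 'cV[R]_d)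
    (mle_that : forall n, (0 < n)%N -> is_mle G (that n)) :
  let Hbar := mx_average (stabilizer G theta) in
  exists g : forall n, n.-tuple 'cV[R]_d -> 'M[R]_d,
    (forall n, (0 < n)%N ->
      measurable_fun setT (g n) /\ forall ys, g n ys \in G) /\
    let err n w := let ys := sample Y n w in
      g n ys *m that n ys - theta in
    bounded_in_probability P (fun n w =>
      n%:R `^ (1 / 2) * enorm (Hbar *m err n w)) /\
    bounded_in_probability P (fun n w =>
      n%:R `^ (1 / 4) * enorm ((1%:M - Hbar) *m err n w)).
Proof.
move=> Hbar; exists (fun n ys => closest G theta (that n ys)); split.
  move=> n n0; have [mthat _] := mle_that n n0.
  split; [exact: measurable_closest|move=> ys; exact: closest_mem].
move=> err.
have msample n : measurable_fun [set: T] (sample Y n).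
  apply/measurable_fun_tnthP => i.
  by rewrite (_ : _ \o _ = Y i)//; apply/funext => w; rewrite /= tnth_mktuple.
have merr n : (0 < n)%N -> measurable_fun [set: T] (err n).
  move=> n0; have [mthat _] := mle_that n n0.
  have mth : measurable_fun [set: T] (fun w => that n (sample Y n w)).
    exact: (measurableT_comp mthat (msample n)).
  apply: measurable_fun_addmx => //; apply: measurable_fun_mulmx => //.
  exact: measurable_closest.
(* Optimality against the parameter 0 gives 0 <= |th| m - |th|^2 / 2, where m is the empirical mean
   of |Y|. *)
have mean_bound n w : (0 < n)%N ->
    enorm (that n (sample Y n w)) <= 2 * emp_mean Y n (@enorm R d) w.
  move=> n0; have [_ /(_ (sample Y n w) 0)] := mle_that n n0.
  rewrite !log_likelihood_emp; set th := that n _.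
  have h1 : emp_mean Y n (fun y => ln (likelihood G y th)) w <=
      emp_mean Y n (fun y => ln (likelihood G y 0) +
        (enorm th * enorm y - enorm th ^+ 2 / 2)) w.
    apply: emp_le => y.
    apply: ln_le_add; [exact: likelihood_gt0|exact: likelihood_gt0|].
    by rewrite [enorm th * _]mulrC; exact: likelihood_le.
  have h2 : emp_mean Y n (fun y => ln (likelihood G y 0) +
        (enorm th * enorm y - enorm th ^+ 2 / 2)) w =
      emp_mean Y n (fun y => ln (likelihood G y 0)) w +
      (enorm th * emp_mean Y n (@enorm R d) w - enorm th ^+ 2 / 2).
    by rewrite /emp_mean big_split /= sumrB mulrDr mulrBr mean_cst// -mulr_sumr mulrCA.
  move=> h3; apply: le_double.
  - exact: enorm_ge0.
  - by apply: emp_ge0 => y; exact: enorm_ge0.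
  - by have := le_trans h3 h1; rewrite h2 lerDl.
(* Half of e pays for a large empirical mean of |Y|, the other half for a large control level; both
   are Markov bounds. *)
have tight (e : R) : 0 < e -> exists C, 0 <= C /\ forall n, (0 < n)%N ->
    exists B : set T, [/\ measurable B, (P B <= e%:E)%E & forall w, ~ B w ->
      enorm (Hbar *m err n w) + enorm (err n w) ^+ 2 <= C / Num.sqrt n%:R].
  move=> e0; have e20 : 0 < e / 2 by rewrite divr_gt0.
  pose m0 := expect0 Y (@enorm R d).
  have m00 : 0 <= m0 by apply: E0_ge0 => y; exact: enorm_ge0.
  pose K := (m0 + 1) / (e / 2).
  have K0 : 0 < K by rewrite divr_gt0// ltr_wpDl.
  (* [2 * K] bounds the estimator off the first bad event, [enorm theta] turns this into a bound on
     its error, and 1 ensures D >= 1. *)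
  pose D := 1 + (2 * K + enorm theta).
  have t0 := enorm_ge0 theta.
  have D1 : 1 <= D.
    by rewrite lerDl; apply: addr_ge0 => //; apply: mulr_ge0 => //; exact: ltW.
  have D0 : 0 <= D by exact: le_trans D1.
  have /choice[s hs] j : exists s, test G theta j = evalp s.
    by case: j => [i|]; [exact: exppoly_coord_test|exact: exppoly_dist_test].
  pose psi j := liftp (s j).
  have spsi j : subexp (psi j) by exact: subexp_liftp.
  have [C0 C00 sep] := separation isoG theta D.
  (* The extra index [None] stands for the constant test 1, which controls the ratio itself. *)
  pose psi1 (j : option (option 'I_d)) : 'cV[R]_d -> R := if j is Some i then psi i else fun=> 1.
  have spsi1 j : subexp (psi1 j).
    by case: j => [j|]; [exact: spsi|exact: subexp_cst].
  have [C1 hC1] := control_family d_gt0 isoG lawY indepY D1 spsi1.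
  pose M := (`|C1| + 1) / (e / 2).
  have M0 : 0 < M by rewrite divr_gt0// ltr_wpDl.
  have E0s dl j : expect0 Y (fun y => (lik_ratio G theta (theta + dl) y - 1) * psi j y) =
      orbit_mean G theta (test G theta j) dl.
    rewrite hs; apply: (E0_test d_gt0 isoG lawY) => g gG; rewrite -hs.
    by case: j => [i|]; [exact: coord_test_orbit|exact: dist_test_orbit].
  have [dl dlD ndl|C' hC'] := rate_bound d_gt0 isoG lawY D0 (ltW M0) C00 spsi.
    by under eq_bigr do rewrite E0s; exact: sep.
  exists `|C'|; split=> // n n0.
  have [X [iX X0 EX hX]] := hC1 n n0.
  have iemp := integrable_emp d_gt0 isoG lawY n (@subexp_enorm R d).
  pose B1 := [set w | (K < emp_mean Y n (@enorm R d) w)%R].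
  pose B2 := [set w | (M < X w)%R].
  have mgt (f : T -> R) a : integrableR P f -> measurable [set w | (a < f w)%R].
    move=> /integrableR_measurable mf; rewrite -[X in measurable X]setTI.
    rewrite (_ : [set w | _] = f @^-1` `]a, +oo[); first exact: mf.
    by apply/seteqP; split=> w /=; rewrite in_itv /= andbT.
  have mB1 : measurable B1 by exact: mgt.
  have mB2 : measurable B2 by exact: mgt.
  exists (B1 `|` B2); split; first exact: measurableU.
    apply: le_trans (measureU2 P mB1 mB2) _.
    rewrite (_ : e = e / 2 + e / 2); last by field.
    rewrite EFinD; apply: leeD.
      apply: Ex_markov => // [w|].
        by apply: emp_ge0 => y; exact: enorm_ge0.
      by rewrite (Ex_emp d_gt0 isoG lawY) ?divfK ?gt_eqF ?lerDl//; exact: subexp_enorm.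
    apply: Ex_markov => //; rewrite divfK ?gt_eqF//; apply: le_trans EX _.
    by apply: le_trans (ler_norm _) _; rewrite lerDl.
  move=> w /not_orP[/negP + /negP]; rewrite -!leNgt => wK wM.
  have [_ mle_w] := mle_that n n0.
  apply: (@le_trans _ _ (C' / Num.sqrt n%:R)); last first.
    by rewrite ler_wpM2r ?ler_norm// invr_ge0 sqrtr_ge0.
  have thE : theta + err n w = closest G theta (that n (sample Y n w)) *m that n (sample Y n w).
    by rewrite addrC subrK.
  apply: (hC' n w _ n0).
  - rewrite /err /=; apply: le_trans (enormB _ _) _.
    rewrite (iso_enorm isoG) ?closest_mem//.
    by have := mean_bound n w n0; rewrite /D; lra.
  - exact: nearest_closest.
  - rewrite thE /log_likelihood.
    under [in leRHS]eq_bigr do rewrite (likelihood_iso isoG) ?closest_mem//.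
    exact: mle_w.
  - exact: (controlled_le wM (hX w None)).
  - by move=> j; exact: (controlled_le wM (hX w (Some j))).
have bip (Z : nat -> T -> R) (F : R -> R) :
    (forall n, (0 < n)%N -> measurable_fun [set: T] (Z n)) ->
    (forall C n w, 0 <= C -> (0 < n)%N ->
      enorm (Hbar *m err n w) + enorm (err n w) ^+ 2 <= C / Num.sqrt n%:R ->
      `|Z n w| <= F C) -> bounded_in_probability P Z.
  move=> mZ ZF e e0; have [C [C0 hC]] := tight e e0.
  exists (F C) => n n0; have [B [mB PB hB]] := hC n n0.
  apply: le_trans PB; apply: le_measure; rewrite ?inE//.
    rewrite -[X in measurable X]setTI.
    rewrite (_ : [set w | _] = (fun w => `|Z n w|) @^-1` `]F C, +oo[).
      by apply: measurableT_comp => //; exact: mZ.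
    by apply/seteqP; split=> w /=; rewrite in_itv /= andbT.
  move=> w /= hw; apply: contrapT => /hB /(ZF _ _ _ C0 n0).
  by rewrite leNgt hw.
have sn n : (0 < n)%N -> 0 < Num.sqrt n%:R :> R by rewrite sqrtr_gt0 ltr0n.
split.
  apply: (bip _ id) => [n n0|C n w C0 n0 h].
    apply: measurable_funM => //; apply: measurable_fun_enorm.
    by apply: measurable_fun_mulmx => //; exact: merr.
  rewrite ger0_norm ?mulr_ge0 ?powR_ge0 ?enorm_ge0// mul1r powR12_sqrt//.
  rewrite mulrC -ler_pdivlMr ?sn//; apply: le_trans h.
  by rewrite lerDl sqr_ge0.
(* The factor 2 bounds the effect of I - Hbar on norms, since Hbar is a contraction. Squaring
   n^(1/4) |err| gives n^(1/2) |err|^2, which is at most C. *)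
apply: (bip _ (fun C => 2 * Num.sqrt C)) => [n n0|C n w C0 n0 h].
  apply: measurable_funM => //; apply: measurable_fun_enorm.
  by apply: measurable_fun_mulmx => //; exact: merr.
have le2 : enorm ((1%:M - Hbar) *m err n w) <= 2 * enorm (err n w).
  rewrite mulmxBl mul1mx; apply: le_trans (enormB _ _) _.
  by have := enorm_average isoG theta (err n w); rewrite -/Hbar; lra.
rewrite ger0_norm ?mulr_ge0 ?powR_ge0 ?enorm_ge0//.
apply: (@le_trans _ _ (n%:R `^ (1 / 4) * (2 * enorm (err n w)))).
  by rewrite ler_wpM2l ?powR_ge0.
rewrite mulrCA ler_wpM2l//.
rewrite -(@ler_pXn2r _ 2)// ?nnegrE ?sqrtr_ge0 ?mulr_ge0 ?powR_ge0 ?enorm_ge0//.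
rewrite sqr_sqrtr// exprMn -powR_mulrn ?powR_ge0// -powRrM.
rewrite (_ : 1 / 4 * 2%:R = 2^-1) ?powR12_sqrt//; last by field.
rewrite mulrC -ler_pdivlMr ?sn//; apply: le_trans h.
by rewrite lerDr enorm_ge0.
Qed.
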